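(* There exist a proper, unbounded metric graph $Y$ of girth at least $2\pi$ and a three-point subset $A\subset Y$ with the following property. Let $X=C(Y)$ be the Euclidean cone over $Y$ with tip $o$ (a CAT(0) space), and identify $Y$ canonically with the unit sphere $\{(1,y):y\in Y\}$ about $o$ in $X$. Then the convex hull of $A$ in $X$ contains a neighborhood of $o$ in $X$. In particular, the closure of the convex hull of $A$ in $X$ is not compact.
   Context: A (metric) graph is a connected, locally finite graph with edges of positive length (not necessarily uniformly bounded below), endowed with the associated path metric; vertices of degree two are allowed. Proper means that all closed bounded balls are compact. The girth of a metric graph is the infimum of the lengths of its simple closed curves. The Euclidean cone $C(Y)$ over a metric space $(Y,d_Y)$ is the set consisting of a tip $o$ and all pairs $(r,y)$ with $r>0$, $y\in Y$; the point $(r,y)$ has distance $r$ from $o$, and $d((r,y),(s,z))^2=r^2+s^2-2rs\cos(\min\{\pi,d_Y(y,z)\})$. CAT(0) spaces are complete by convention. For a proper metric graph $Y$ of girth at least $2\pi$, the cone $C(Y)$ is CAT(0). In a CAT(0) space $X$ any two points $x,y$ are joined by a unique geodesic $xy$. The convex hull of $A\subset X$ (not closed in general) is the smallest subset containing $A$ that contains $xy$ for all of its points $x,y$; equivalently it is $\bigcup_{i\ge1}A_i$ with $A_1=A$ and $A_{i+1}=A_i\cup\bigcup_{x,y\in A_i}xy$. *)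

(* Defs.v *)
From HB Require Import structures.
From mathcomp Require Import all_boot all_order all_algebra.
From mathcomp Require Import all_classical all_reals all_analysis.
From mathcomp Require Import ring lra.

Set Implicit Arguments.
Unset Strict Implicit.
Unset Printing Implicit Defensive.

Import Order.TTheory GRing.Theory Num.Theory.
Import numFieldNormedType.Exports.

Local Open Scope classical_set_scope.
Local Open Scope ring_scope.

Section MetricNotions.
Context {R : realType} {Y : metricType R}.

Definition proper_space : Prop :=
  forall (x : Y) (r : R), compact [set y : Y | mdist x y <= r].

Definition unbounded_space : Prop :=
  forall M : R, exists x y : Y, M < mdist x y.

(* The supremum over subdivisions, as in the library's [total_variation];
   [itv_partition a b s] lists the subdivision without its first point [a]. *)
Definition curve_length (a b : R) (c : R -> Y) : \bar R :=
  ereal_sup [set (let F := c \o nth b (a :: s) in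
                  \sum_(0 <= n < size s) mdist (F n) (F n.+1))%:E
            | s in itv_partition a b].

(* Only the values of [c] on [0, 1] matter. *)
Definition simple_closed_curve (c : R -> Y) : Prop :=
  [/\ {within `[0, 1], continuous c},
      c 0 = c 1
    & {in `[0, 1[ &, injective c}].

(* It is +oo when there is no simple closed curve. *)
Definition girth : \bar R :=
  ereal_inf [set curve_length 0 1 c | c in simple_closed_curve].

Definition geodesic (l : R) (c : R -> Y) : Prop :=
  0 <= l /\ {in `[0, l] &, forall s t, mdist (c s) (c t) = `|s - t|}.

(* The points lying on some geodesic from [x] to [y]; in a CAT(0) space this is
   the unique geodesic xy. *)
Definition geodesic_segment (x y : Y) : set Y :=
  [set z | exists l c, [/\ geodesic l c, c 0 = x, c l = y
                         & exists2 t, t \in `[0, l] & c t = z]].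

Definition geodesically_convex (C : set Y) : Prop :=
  forall x y, C x -> C y -> geodesic_segment x y `<=` C.

Definition convex_hull (A : set Y) : set Y := smallest geodesically_convex A.

End MetricNotions.

Arguments proper_space {R} Y.
Arguments unbounded_space {R} Y.
Arguments girth {R} Y.

(* [chain len param x y l]: y can be reached from x by finitely many steps, each
   staying in one closed edge, of total length l. *)
Inductive chain {R : realType} {Y E : Type}
    (len : E -> R) (param : E -> R -> Y) : Y -> Y -> R -> Prop :=
| chain_nil x : chain len param x x 0
| chain_cons e s t y l :
    s \in `[0, len e] -> t \in `[0, len e] ->
    chain len param (param e t) y l ->
    chain len param (param e s) y (`|s - t| + l).

(* A presentation of the metric space Y as a metric graph: the edge [e] is the
   image of [0, edge_len e] under [edge_param e], its ends are vertices and the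
   open edges partition the complement of the vertex set. Loops and multiple
   edges are allowed. By [graph_path_metric] the distance is the infimum of the
   lengths of edge paths, as in the path metric of a graph; this also makes each
   [edge_param e] continuous on [0, edge_len e]. *)
Record metric_graph {R : realType} (Y : metricType R) := MetricGraph {
  vertex : set Y ;
  edge : Type ;
  edge_len : edge -> R ;
  edge_param : edge -> R -> Y ;
  edge_len_gt0 : forall e, 0 < edge_len e ;
  edge_param_start : forall e, vertex (edge_param e 0) ;
  edge_param_end : forall e, vertex (edge_param e (edge_len e)) ;
  edge_param_inner :
    forall e t, t \in `]0, edge_len e[ -> ~ vertex (edge_param e t) ;
  edge_param_inj : forall e e' s t,
    s \in `]0, edge_len e[ -> t \in `]0, edge_len e'[ ->
    edge_param e s = edge_param e' t -> e = e' /\ s = t ;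
  graph_cover : forall y, vertex y \/
    exists e, exists2 t, t \in `]0, edge_len e[ & edge_param e t = y ;
  graph_locally_finite : forall v, vertex v ->
    finite_set [set e | edge_param e 0 = v \/ edge_param e (edge_len e) = v] ;
  graph_connected : forall x y, exists l, chain edge_len edge_param x y l ;
  graph_path_metric : forall x y,
    mdist x y = inf [set l | chain edge_len edge_param x y l]
}.

Inductive cone (R : realType) (Y : Type) : Type :=
| tip
| cone_pt (r : R) (r_gt0 : 0 < r) (y : Y).

Arguments tip {R Y}.
Arguments cone_pt {R Y} r r_gt0 y.

HB.instance Definition _ (R : realType) (Y : Type) := gen_eqMixin (cone R Y).
HB.instance Definition _ (R : realType) (Y : Type) :=
  gen_choiceMixin (cone R Y).

Section LawOfCosines.
Context {R : realType}.
Implicit Types a b c d r s t : R.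

Definition cosine_dist r s a : R :=
  Num.sqrt (r ^+ 2 + s ^+ 2 - 2 * r * s * cos a).

Lemma cosine_dist_arg_ge r s a : 0 <= r -> 0 <= s ->
  (r - s) ^+ 2 <= r ^+ 2 + s ^+ 2 - 2 * r * s * cos a.
Proof.
move=> r0 s0; have := mulr_ge0 r0 s0; have := cos_le1 a.
by set k := cos a => k1 rs0; nra.
Qed.

Lemma cosine_dist_arg_le r s a : 0 <= r -> 0 <= s ->
  r ^+ 2 + s ^+ 2 - 2 * r * s * cos a <= (r + s) ^+ 2.
Proof.
move=> r0 s0; have := mulr_ge0 r0 s0; have := cos_geN1 a.
by set k := cos a => k1 rs0; nra.
Qed.

Lemma cosine_dist_geB r s a : 0 <= r -> 0 <= s -> `|r - s| <= cosine_dist r s a.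
Proof. by move=> r0 s0; rewrite -sqrtr_sqr ler_wsqrtr// cosine_dist_arg_ge. Qed.

Lemma cosine_dist_leD r s a : 0 <= r -> 0 <= s -> cosine_dist r s a <= r + s.
Proof.
move=> r0 s0; rewrite -[leRHS]ger0_norm ?addr_ge0// -sqrtr_sqr.
by rewrite ler_wsqrtr// cosine_dist_arg_le.
Qed.

Lemma cosine_dist_sym r s a : cosine_dist r s a = cosine_dist s r a.
Proof. by congr Num.sqrt; ring. Qed.

Lemma cosine_dist_pi r s : 0 <= r -> 0 <= s -> cosine_dist r s pi = r + s.
Proof.
move=> r0 s0; rewrite -[RHS]ger0_norm ?addr_ge0// -sqrtr_sqr.
by congr Num.sqrt; rewrite cospi; ring.
Qed.

Lemma cosine_dist0 r s a : 0 < r -> 0 < s -> a \in `[0, pi] ->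
  cosine_dist r s a = 0 -> r = s /\ a = 0.
Proof.
move=> r0 s0 ai /eqP; rewrite sqrtr_eq0 => arg0.
have rs : r = s.
  have := cosine_dist_arg_ge a (ltW r0) (ltW s0).
  move=> /le_trans/(_ arg0) h; apply/eqP; rewrite -subr_eq0 -sqrf_eq0.
  by rewrite eq_le h sqr_ge0.
split=> //; apply: cos_inj => //; first by rewrite in_itv/= lexx pi_ge0.
rewrite cos0; apply/eqP; rewrite eq_le cos_le1/=.
have r2 : 0 < r * r by rewrite mulr_gt0.
rewrite -(ler_pM2l r2); move: arg0; rewrite -rs; nra.
Qed.

Lemma cosine_dist_mono r s : 0 <= r -> 0 <= s ->
  {in `[0, pi] &, {homo cosine_dist r s : a b / a <= b}}.
Proof.
move=> r0 s0 a b ai bi; rewrite le_eqVlt => /predU1P[->//|ab].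
rewrite ler_wsqrtr// lerD2l lerN2 ler_wpM2l ?mulr_ge0//.
by rewrite ltW// ltr_cos.
Qed.

Lemma sqrt_sum_sqr_triangle a b c d :
  Num.sqrt ((a + c) ^+ 2 + (b + d) ^+ 2) <=
  Num.sqrt (a ^+ 2 + b ^+ 2) + Num.sqrt (c ^+ 2 + d ^+ 2).
Proof.
set u := Num.sqrt (a ^+ 2 + b ^+ 2); set v := Num.sqrt (c ^+ 2 + d ^+ 2).
have u0 : 0 <= u := sqrtr_ge0 _.
have v0 : 0 <= v := sqrtr_ge0 _.
have uE : u ^+ 2 = a ^+ 2 + b ^+ 2 by rewrite sqr_sqrtr ?addr_ge0 ?sqr_ge0.
have vE : v ^+ 2 = c ^+ 2 + d ^+ 2 by rewrite sqr_sqrtr ?addr_ge0 ?sqr_ge0.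
have uv : a * c + b * d <= u * v.
  apply: (le_trans (ler_norm _)); rewrite -sqrtr_sqr.
  rewrite -[leRHS]ger0_norm ?mulr_ge0// -[leRHS]sqrtr_sqr ler_wsqrtr//.
  by rewrite exprMn uE vE; have := sqr_ge0 (a * d - b * c); nra.
rewrite -[leRHS]ger0_norm ?addr_ge0// -[leRHS]sqrtr_sqr ler_wsqrtr//.
by rewrite [leRHS]sqrrD uE vE; nra.
Qed.

Lemma cosine_dist_triangle_flat r s t a b :
  cosine_dist r t (a + b) <= cosine_dist r s a + cosine_dist s t b.
Proof.
have := sqrt_sum_sqr_triangle (r * cos a - s) (r * sin a)
  (s - t * cos b) (t * sin b).
have ca := sin2cos2 a; have cb := sin2cos2 b.
congr (Num.sqrt _ <= Num.sqrt _ + Num.sqrt _).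
- by rewrite cosD; ring: ca cb.
- by ring: ca.
- by ring: cb.
Qed.

Lemma cosine_dist_triangle r s t a b c : 0 <= r -> 0 <= s -> 0 <= t ->
  a \in `[0, pi] -> b \in `[0, pi] -> c \in `[0, pi] -> c <= a + b ->
  cosine_dist r t c <= cosine_dist r s a + cosine_dist s t b.
Proof.
move=> r0 s0 t0 ai bi ci cab.
have /[!in_itv]/= /andP[a0 api] := ai; have /[!in_itv]/= /andP[b0 bpi] := bi.
have [abpi|/ltW abpi] := leP (a + b) pi.
  apply: le_trans (cosine_dist_triangle_flat r s t a b).
  by apply: cosine_dist_mono => //; rewrite in_itv/= addr_ge0.
apply: (le_trans (cosine_dist_leD c r0 t0)).
rewrite -cosine_dist_pi// -(subrK b pi).
apply: (le_trans (cosine_dist_triangle_flat _ s _ _ _)); rewrite lerD2r.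
apply: cosine_dist_mono => //; last by rewrite lerBlDr.
by rewrite in_itv/= subr_ge0 bpi lerBlDr lerDl.
Qed.

End LawOfCosines.

Section ConeMetric.
Context {R : realType} {Y : metricType R}.
Implicit Types p q : cone R Y.

Let angle (y z : Y) : R := Num.min pi (mdist y z).

Definition cone_dist p q : R :=
  match p, q with
  | tip, tip => 0
  | tip, cone_pt s _ _ => s
  | cone_pt r _ _, tip => r
  | cone_pt r _ y, cone_pt s _ z =>
      Num.sqrt (r ^+ 2 + s ^+ 2 - 2 * r * s * cos (Num.min pi (mdist y z)))
  end.

Let angle_itv y z : angle y z \in `[0, pi].
Proof. by rewrite in_itv/= le_min pi_ge0 mdist_ge0 ge_min lexx. Qed.

Let cone_dist_ptE r r0 y s s0 z :
  cone_dist (cone_pt r r0 y) (cone_pt s s0 z) = cosine_dist r s (angle y z).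
Proof. by []. Qed.

Let cone_distxx p : cone_dist p p = 0.
Proof.
case: p => // r r0 y; rewrite /= mdistxx min_r ?pi_ge0// cos0.
by apply/eqP; rewrite sqrtr_eq0; lra.
Qed.

Let cone_dist_positivity p q : cone_dist p q = 0 -> p = q.
Proof.
case: p q => [|r r0 y] [|s s0 z]//.
- by move=> /eqP; rewrite gt_eqF.
- by move=> /eqP; rewrite gt_eqF.
rewrite cone_dist_ptE => /(cosine_dist0 r0 s0 (angle_itv _ _))[rs yz].
have {}yz : y = z.
  apply: (@mdist_positivity R); move: yz; rewrite /angle minEle.
  by case: ifP => // _ /eqP; rewrite gt_eqF ?pi_gt0.
by rewrite yz; case: _ / rs s0 => s0; rewrite (bool_irrelevance r0 s0).
Qed.

Let cone_dist_sym p q : cone_dist p q = cone_dist q p.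
Proof.
case: p q => [|r r0 y] [|s s0 z]//.
by rewrite !cone_dist_ptE cosine_dist_sym /angle metric_sym.
Qed.

Let cone_dist_triangle q p u : cone_dist p u <= cone_dist p q + cone_dist q u.
Proof.
case: p q u => [|r r0 y] [|s s0 z] [|t t0 w];
  rewrite ?cone_dist_ptE /= ?addr0 ?add0r//.
- by rewrite addr_ge0// ltW.
- rewrite -lerBlDl; apply: le_trans (cosine_dist_geB _ (ltW s0) (ltW t0)).
  by rewrite distrC ler_norm.
- exact: cosine_dist_leD (ltW r0) (ltW t0).
- rewrite -lerBlDr; apply: le_trans (cosine_dist_geB _ (ltW r0) (ltW s0)).
  exact: ler_norm.
- apply: cosine_dist_triangle; rewrite ?(ltW r0) ?(ltW s0) ?(ltW t0)//.
  rewrite /angle; have := metric_triangle y z w; have := @pi_ge0 R.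
  have := mdist_ge0 y z; have := mdist_ge0 z w.
  case: (leP pi (mdist y z)); case: (leP pi (mdist z w));
    by case: (leP pi (mdist y w)) => *; lra.
Qed.

HB.instance Definition _ := isMetric.Build R (cone R Y)
  cone_distxx cone_dist_positivity cone_dist_sym cone_dist_triangle.

Definition unit_sphere_pt (y : Y) : cone R Y := cone_pt 1 ltr01 y.

End ConeMetric.

(* Main.v *)
Require Import Defs.
From HB Require Import structures.
From mathcomp Require Import all_boot all_order all_algebra.
From mathcomp Require Import all_classical all_reals all_analysis.
From mathcomp Require Import ring lra zify.

(** In the cone X over Y, two points at radius r over the ends of a geodesic arc
of Y of length 2 l < pi span a flat sector, and the chord between them meets
every direction of the arc, at radius at least r cos l. So if Y is enlarged by
an arc of length 2 l < pi glued at two points u and w, and the convex hull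
contains the points of radius r over u and w, then it also contains points of
radius r cos l over the new arc. No cycle shorter than 2 pi appears as long as
u and w have distance at least 2 pi - 2 l. The graph Y is obtained from three
points by gluing such arcs again and again, in levels. If l_k is the half length
of the arcs of level k, the radii lose a factor cos l_k at level k, so they stay
bounded away from 0 when the sum of the l_k ^ 2 is finite, and Y is unbounded
when the sum of the l_k is infinite. Here l_k is of order 1 / k.

The vertices of Y are the natural numbers. The three given points are 0, 1, 2,
and n >= 3 is the midpoint of an arc between two smaller vertices, its parents,
to which it is joined by edges of length [arm n]. The girth becomes a
combinatorial condition: the parents of n are not joined by a walk of at most
[gap n] steps through vertices below n. A cycle with largest vertex n then has at
least gap n + 3 edges ([cycle_gap]), each at least as long as arm n, and
(gap n + 3) * arm n >= 2 pi ([gap_arm]). As gap n tends to infinity, the levels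
must grow exponentially. They double here, each vertex having at most 12
children, so that the available vertices of a level always outnumber the balls
of gap n steps, and parents can be found by pigeonhole ([admissible_extend]).
Below 1024 the parents are given by an explicit pattern ([seed_parents]).

In the metric space built from such a graph ([point]) the distance is an infimum
over chains, and every lower bound for it comes from a function that is Lipschitz
along the edges. For the girth, the relevant function measures the way around a
cycle from one side of a point z to the other ([edge_potential]). A simple closed
curve through z leaves z on one side and returns on the other, since otherwise
the intermediate value theorem would produce a double point ([cut_length]). The
same potentials show that the glued arcs are geodesics ([cap_isometric]).

The hull contains a point over each vertex ([hull_vertex]). As Y is unbounded,
two of these points lie over vertices at distance at least pi, so the hull
contains the tip and is star-shaped about it. The radii can therefore be made
equal on each level, and the estimate above applies level by level
([hull_levels], [hull_uniform]). It follows that the hull contains a ball about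
the tip ([hull_nbhs_tip]), and this ball contains infinitely many points with
pairwise distances bounded below ([hull_not_precompact]). *)

Set Implicit Arguments.
Unset Strict Implicit.
Unset Printing Implicit Defensive.

Import Order.TTheory GRing.Theory Num.Theory.
Import numFieldNormedType.Exports.

Local Open Scope classical_set_scope.
Local Open Scope ring_scope.

(** * Choosing the parents *)

Section Parents.
Local Open Scope nat_scope.

(** Dependent choice for a condition that looks at the terms up to the current one:
finite prefixes are prolonged one term at a time, and what is chosen later does
not disturb what was chosen before. *)
Lemma extend_sequence (T : Type) (good : (nat -> T) -> nat -> Prop)
    (N : nat) (P0 : nat -> T) :
  (forall P Q n, (forall i, i <= n -> P i = Q i) -> good P n -> good Q n) ->
  (forall P n, N <= n -> (forall i, i < n -> good P i) ->
    exists x, good (fun i => if i == n then x else P i) n) ->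
  (forall i, i < N -> good P0 i) ->
  exists P, (forall i, i < N -> P i = P0 i) /\ forall n, good P n.
Proof.
move=> loc step init.
have step' Pn : exists x, N <= Pn.2 -> (forall i, i < Pn.2 -> good Pn.1 i) ->
    good (fun i => if i == Pn.2 then x else Pn.1 i) Pn.2.
  have [[le gd]|no] := pselect (N <= Pn.2 /\ forall i, i < Pn.2 -> good Pn.1 i).
    by have [x] := step _ _ le gd; exists x.
  by exists (P0 0) => le gd; case: no.
have [next nextP] := choice step'.
pose fix S k := if k is j.+1 then
  fun i => if i == N + j then next (S j, N + j) else S j i else P0.
have SS k i j : i < N + k -> S (k + j) i = S k i.
  move=> ik; elim: j => [|j IH]; first by rewrite addn0.
  by rewrite addnS /= ltn_eqF// (leq_trans ik)// addnA leq_addr.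
have Sgood k : forall i, i < N + k -> good (S k) i.
  elim: k => [|k IH] i; first by rewrite addn0; exact: init.
  rewrite addnS ltnS leq_eqVlt => /predU1P[->|ik].
    by apply: (nextP (S k, N + k)) => //=; exact: leq_addr.
  apply: loc (IH _ ik) => j ji.
  by rewrite -[k.+1]addn1 SS// (leq_ltn_trans ji).
have PS k i : i < N + k -> S (i.+1 - N) i = S k i.
  move=> ik; have [le|lt] := leqP (i.+1 - N) k.
    by rewrite -(subnKC le) SS//; lia.
  by rewrite -(subnKC (ltnW lt)) SS.
exists (fun i => S (i.+1 - N) i); split=> [i iN|n].
  by rewrite (PS 0)// addn0.
have nN : n < N + n.+1 by lia.
by apply: loc (Sgood _ _ nN) => i le; rewrite (PS n.+1)//; lia.
Qed.

(** The vertices 0, 1, 2 have no parents: the hull starts from them. *)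
Definition parent (P : nat -> nat * nat) (u v : nat) : bool :=
  (2 < u) && ((v == (P u).1) || (v == (P u).2)).

Definition adj P u v := parent P u v || parent P v u.

Definition adj_below P n u v := [&& u < n, v < n & adj P u v].

Definition nchildren P n v := count (fun i => parent P i v) (iota 0 n).

(** Everything below 2048 is level 0. The other levels are dyadic intervals, so that
the number of vertices doubles from one level to the next. *)
Definition level n := trunc_log 2 n - 10.

(** A quarter of the level suffices for the girth, as the arms are of order
1 / level, and it is small enough for the pigeonhole: the level doubles four
times, hence grows by 16 > 15, each time the gap grows by 1. *)
Definition gap n := 2 + level n %/ 4.

(** Bounding the number of children bounds the degrees, hence the size of balls;
placing the parents in the previous dyadic interval makes the level go down by
one; and the last condition says that the two edges below n close no short
cycle. *)
Definition admissible P n := 2 < n ->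
  [/\ (P n).1 < n, (P n).2 < n,
      nchildren P n (P n).1 < 12 /\ nchildren P n (P n).2 < 12,
      2 ^ 10 <= n -> forall v, parent P n v ->
        2 ^ (trunc_log 2 n).-1 <= v < 2 ^ trunc_log 2 n
    & forall p, path (adj_below P n) (P n).1 p -> size p <= gap n ->
        last (P n).1 p != (P n).2].

Lemma adjC P u v : adj P u v = adj P v u.
Proof. by rewrite /adj orbC. Qed.

Lemma adj_below_local P Q n : (forall i, i < n -> P i = Q i) ->
  adj_below P n =2 adj_below Q n.
Proof.
move=> PQ u v; rewrite /adj_below /adj /parent.
by case: ltnP => //= un; case: ltnP => //= vn; rewrite !PQ.
Qed.

Lemma nchildren_local P Q n v : (forall i, i < n -> P i = Q i) ->
  nchildren P n v = nchildren Q n v.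
Proof.
move=> PQ; apply: eq_in_count => i; rewrite mem_iota add0n => /= ni.
by rewrite /parent PQ.
Qed.

Lemma admissible_local P Q n : (forall i, i <= n -> P i = Q i) ->
  admissible P n -> admissible Q n.
Proof.
move=> PQ gP n2; have PQ' i : i < n -> P i = Q i by move=> /ltnW; exact: PQ.
have [] := gP n2; rewrite /parent -(PQ n)// !(nchildren_local _ PQ').
move=> h1 h2 h3 h4 h5; split=> // p.
rewrite -(eq_path (adj_below_local PQ')); exact: h5.
Qed.

Lemma nchildrenS P n v : nchildren P n.+1 v = nchildren P n v + parent P n v.
Proof. by rewrite /nchildren -addn1 iotaD count_cat /= addn0. Qed.

Lemma nchildren_le P n v : (forall i, i < n -> admissible P i) ->
  nchildren P n v <= 12.
Proof.
elim: n => [//|n IH] gP; rewrite nchildrenS.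
have {}IH : nchildren P n v <= 12.
  by apply: IH => i /ltnW; exact: gP.
case: (boolP (parent P n v)) => [/andP[n2 pn]|_]; last by rewrite addn0.
have [_ _ [h1 h2] _ _] := gP n (ltnSn n) n2.
by case/orP: pn => /eqP->; rewrite addn1.
Qed.

(** Staying at the same vertex is allowed, so that shorter walks are included. *)
Fixpoint reach P n m u := if m is m'.+1 then
  flatten [seq x :: [seq y <- iota 0 n | adj P x y] | x <- reach P n m' u]
  else [:: u].

Lemma reachP P n u p : path (adj_below P n) u p ->
  last u p \in reach P n (size p) u.
Proof.
elim/last_ind: p => [_|q v IH]; first by rewrite inE.
rewrite rcons_path last_rcons size_rcons => /andP[/IH uq /and3P[_ vn av]].
apply/flatten_mapP; exists (last u q) => //.
by rewrite inE mem_filter mem_iota av vn orbT.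
Qed.

Lemma reach_subset P n u m k : {subset reach P n m u <= reach P n (m + k) u}.
Proof.
elim: k => [|k IH] x; first by rewrite addn0.
rewrite addnS => /IH xm; apply/flatten_mapP; exists x => //.
exact: mem_head.
Qed.

Lemma count_parent P u (s : seq nat) : uniq s -> count (parent P u) s <= 2.
Proof.
move=> us; apply: (@leq_trans (count (predU (pred1 (P u).1) (pred1 (P u).2)) s)).
  by apply: sub_count => v /andP[].
have := count_predUI (pred1 (P u).1) (pred1 (P u).2) s.
by rewrite !count_uniq_mem//; case: (_ \in _); case: (_ \in _); lia.
Qed.

Lemma size_reach P n m u : (forall i, i < n -> admissible P i) ->
  size (reach P n m u) <= 15 ^ m.
Proof.
move=> gP; elim: m => [//|m IH] /=; rewrite expnS mulnC size_flatten /shape.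
apply: leq_trans (leq_mul IH (leqnn 15)).
elim: (reach P n m u) => [//|x s IHs]; rewrite /= mulSn leq_add// ltnS.
rewrite size_filter.
have U := count_predUI (parent P x) (fun y => parent P y x) (iota 0 n).
have := count_parent P x (iota_uniq 0 n); have := @nchildren_le P n x gP.
rewrite /nchildren => c1 c2.
change (count (predU (parent P x) (fun y => parent P y x)) (iota 0 n) <= 14).
by move: U c1 c2; clear; lia.
Qed.

Lemma big_nat_count (a : pred nat) m n :
  \sum_(m <= i < n) (a i : nat) = count a (iota m (n - m)).
Proof. by rewrite -sum1_count /index_iota [RHS]big_mkcond; apply: eq_bigr => i; case: (a i). Qed.

(** Double counting. The children of the 2 ^ (t - 1) vertices of the previous dyadic
interval are among the fewer than 3 * 2 ^ (t - 1) vertices from there to n, and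
each of these has at most two parents. So at most half of the interval can have
12 children. *)
Lemma front_available P n t : t = trunc_log 2 n ->
  2 ^ 10 <= n -> (forall i, i < n -> admissible P i) ->
  2 ^ (t - 2) <= count (fun v => nchildren P n v < 12) (iota (2 ^ t.-1) (2 ^ t.-1)).
Proof.
move=> tE n10 gP.
have t10 : 10 <= t by rewrite tE -(@trunc_expnK 2 10 isT) leq_trunc_log.
have [tn nt] : 2 ^ t <= n /\ n < 2 ^ t.+1.
  by apply/andP; rewrite tE; apply: trunc_log_bounds => //; apply: leq_trans n10.
have e1 : 2 ^ t = 2 * 2 ^ t.-1 by rewrite -expnS prednK// (leq_trans _ t10).
have e2 : 2 ^ t.-1 = 2 * 2 ^ (t - 2).
  by rewrite -expnS; congr (2 ^ _); move: t10; clear; lia.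
set I := iota _ _; set a := fun v => _.
have eI : I = index_iota (2 ^ t.-1) (2 ^ t).
  by rewrite /index_iota e1 mul2n -addnn addnK.
have sumle : \sum_(v <- I) nchildren P n v <= 6 * 2 ^ t.-1.
  have -> : \sum_(v <- I) nchildren P n v =
            \sum_(0 <= i < n) \sum_(v <- I) (parent P i v : nat).
    rewrite exchange_big/=; apply: eq_bigr => v _.
    by rewrite (big_nat_count (fun i => parent P i v)) subn0.
  have nt1 : 2 ^ t.-1 <= n by move: e1 tn; clear; lia.
  rewrite (@big_cat_nat _ _ _ (2 ^ t.-1))//= big_nat big1 ?add0n.
    apply: (@leq_trans (\sum_(2 ^ t.-1 <= i < n) 2)); last first.
      by rewrite sum_nat_const_nat; move: e1 nt; rewrite expnS; clear; lia.
    apply: leq_sum => i _.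
    by rewrite eI big_nat_count count_parent// iota_uniq.
  move=> i /andP[_ it]; rewrite big_seq big1// => v; rewrite mem_iota => /andP[vt _].
  apply/eqP; rewrite eqb0; apply/negP => /andP[i2 pv].
  have [h1 h2 _ _ _] := gP i (leq_trans it nt1) i2.
  by case/orP: pv => /eqP e; move: h1 h2 vt it; rewrite -e; clear; lia.
have sat : 12 * count (predC a) I <= \sum_(v <- I) nchildren P n v.
  rewrite mulnC -sum1_count big_distrl/= [leqRHS](bigID a)/=.
  apply: leq_trans (leq_addl _ _); apply: leq_sum => v; rewrite /a -leqNgt.
  by rewrite mul1n.
have := count_predC a I; rewrite size_iota.
by move: sat sumle; rewrite e2; clear; lia.
Qed.

(** Because 15 ^ 2 < 2 ^ 8 and 15 < 2 ^ 4. *)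
Lemma ball_lt_front t q : 10 + 4 * q <= t -> 15 ^ (2 + q) < 2 ^ (t - 2).
Proof.
move=> qt; apply: (@leq_trans (2 ^ (8 + 4 * q))); last by rewrite leq_exp2l//; lia.
rewrite (expnD 15 2) (expnD 2 8) (expnM 2 4); apply: (@leq_ltn_trans (15 ^ 2 * (2 ^ 4) ^ q)).
  by rewrite leq_mul2l; case: q {qt} => // q; rewrite leq_exp2r.
by rewrite ltn_pmul2r ?expn_gt0.
Qed.

(** Pigeonhole: the ball of gap n steps about an available vertex a has fewer
elements than there are available vertices, so some available b lies outside. *)
Lemma admissible_extend P n : 2 ^ 10 <= n -> (forall i, i < n -> admissible P i) ->
  exists ab, admissible (fun i => if i == n then ab else P i) n.
Proof.
move=> n10 gP; pose t := trunc_log 2 n.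
have t10 : 10 <= t by rewrite /t -(@trunc_expnK 2 10 isT) leq_trunc_log.
have [tn nt] : 2 ^ t <= n /\ n < 2 ^ t.+1.
  by apply/andP; apply: trunc_log_bounds => //; apply: leq_trans n10.
have avail := front_available (erefl t) n10 gP.
pose U := [seq v <- iota (2 ^ t.-1) (2 ^ t.-1) | nchildren P n v < 12].
have e1 : 2 ^ t.-1 + 2 ^ t.-1 = 2 ^ t.
  by rewrite addnn -mul2n -expnS prednK// (leq_trans _ t10).
have UP v : v \in U -> nchildren P n v < 12 /\ 2 ^ t.-1 <= v < 2 ^ t.
  by rewrite mem_filter mem_iota e1 => /andP[].
have sU : 15 ^ gap n < size U.
  rewrite size_filter; apply: leq_trans avail; apply: ball_lt_front.
  rewrite /level -/t; have := leq_trunc_div (t - 10) 4; move: t10; clear; lia.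
have [a aU] : exists a, a \in U.
  by case: (U) sU => // a s _; exists a; rewrite mem_head.
have [b bU bfar] : exists2 b, b \in U & b \notin reach P n (gap n) a.
  apply/hasP; rewrite -[has _ _]negbK -all_predC; apply/allP => near.
  have : size U <= size (reach P n (gap n) a).
    apply: uniq_leq_size; first by rewrite filter_uniq// iota_uniq.
    by move=> b /near; rewrite /= negbK.
  by rewrite leqNgt (leq_ltn_trans (size_reach _ _ gP)).
have PQ i : i < n -> P i = if i == n then (a, b) else P i.
  by move=> /ltn_eqF->.
have [a12 abd] := UP a aU; have [b12 bbd] := UP b bU.
have an : a < n by case/andP: abd => _ /leq_trans; apply.
have bn : b < n by case/andP: bbd => _ /leq_trans; apply.
exists (a, b) => _; rewrite /parent eqxx/= -!(nchildren_local _ PQ).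
split=> //.
  by move=> _ v /andP[_] /orP[] /eqP ->.
move=> p; rewrite -(eq_path (adj_below_local PQ)) => /reachP pr pn.
apply: contraNneq bfar => <-.
by rewrite -(subnKC pn); exact: reach_subset.
Qed.

(** The pigeonhole needs many vertices to start from. A path, which gives n the
parent n - 1, with one chord from each n back to n - 8 or n - 5 according to
parity has no cycle of fewer than five edges. The first nine vertices connect
this pattern to the three roots. *)
Definition seed_parents n : nat * nat :=
  if n < 9 then nth (0, 0)
    [:: (0, 0); (0, 0); (0, 0); (0, 1); (1, 2); (0, 2); (3, 2); (4, 0); (7, 6)] n
  else (n - 1, n - (if odd n then 8 else 5)).

Definition seed_check n : bool :=
  let P := seed_parents in let ab := P n in let (a, b) := ab in
  [&& a < n, b < n, a != b, ~~ adj P a b, n <= a + 8, n <= b + 8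
    & all (fun x => (x < n) && adj P a x ==> ~~ adj P x b) (iota (a - 8) 17)].

Lemma seed_checked : all seed_check (iota 3 23).
Proof. by []. Qed.

Lemma seed_parent u v : 9 <= u -> parent seed_parents u v ->
  v + 1 = u \/ v + (if odd u then 8 else 5) = u.
Proof.
move=> u9; rewrite /parent /seed_parents [u < 9]ltnNge u9 /= => /andP[_].
by case/orP=> /eqP ->; [left|right]; rewrite subnK//; [|case: ifP => _]; apply: leq_trans u9.
Qed.

Lemma seed_parent_window u v : parent seed_parents u v -> v < u <= v + 8.
Proof.
move=> puv; have /andP[u2 pv] := puv; have [u9|u9] := leqP 9 u.
  by have := seed_parent u9 puv; case: ifP => _; lia.
have : u \in iota 3 23 by rewrite mem_iota u2 (leq_trans u9).
move=> /(allP seed_checked); rewrite /seed_check.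
move: pv; case: (seed_parents u) => a b /=.
by case/orP=> /eqP -> /and5P[ai bi _ _ /and3P[a8 b8 _]]; apply/andP; split.
Qed.

Lemma seed_adj u v : 17 <= u -> adj seed_parents u v ->
  [\/ v + 1 = u, v + (if odd u then 8 else 5) = u, u + 1 = v
    | u + (if odd v then 8 else 5) = v].
Proof.
move=> u17 /orP[] puv.
  have [|h|h] := seed_parent _ puv; first by lia.
    by constructor 1.
  by constructor 2.
have /andP[uv _] := seed_parent_window puv.
have [|h|h] := seed_parent _ puv; first by lia.
  by constructor 3.
by constructor 4.
Qed.

(** Adjacent vertices differ by 1, 5 or 8, whereas the neighbours of n - 1 below n
differ from the other parent of n by 2, 3, 4 or 6. The irregular beginning is
checked by computation. *)
Lemma seed_far i : 2 < i -> let P := seed_parents in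
  [/\ (P i).1 < i, (P i).2 < i, (P i).1 != (P i).2, ~~ adj P (P i).1 (P i).2
    & forall x, x < i -> adj P (P i).1 x -> ~~ adj P x (P i).2].
Proof.
move=> i2 P; have [i26|i26] := leqP 26 i; last first.
  have : i \in iota 3 23 by rewrite mem_iota i2.
  move=> /(allP seed_checked); rewrite /seed_check -/P.
  case: (P i) => a b /and5P[-> -> -> -> /and3P[_ _ /allP far]]; split=> // x xi ax.
  suff /far : x \in iota (a - 8) 17 by rewrite xi ax.
  by case/orP: (ax) => /seed_parent_window; rewrite mem_iota /=; lia.
have -> : P i = (i - 1, i - (if odd i then 8 else 5)).
  by rewrite /P /seed_parents ltnNge (leq_trans _ i26).
split; rewrite /=.
- by lia.
- by case: ifP => _; lia.
- by apply/eqP; case: ifP => _; lia.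
- have i17 : 17 <= i - 1 by lia.
  apply/negP => /(seed_adj i17) [h|h|h|h]; move: h;
    try case: ifP => ?; try case: ifP => ?; lia.
move=> x xi; have i17 : 17 <= i - 1 by lia.
move=> /(seed_adj i17) ax; apply/negP => xb.
have {}ax : x + 1 = i - 1 \/ x + (if odd (i - 1) then 8 else 5) = i - 1.
  by case: ax => h; [left|right|lia|move: h; case: ifP => _; lia].
have x17 : 17 <= x by move: ax; case: ifP => _; lia.
have := seed_adj x17 xb; move: ax; rewrite oddB ?(leq_trans _ i26)//.
by case: (odd i) => /=; case: (odd x) => ax [h|h|h|h]; move: ax h; try case: ifP => ?; lia.
Qed.

Lemma seed_admissible i : i < 2 ^ 10 -> admissible seed_parents i.
Proof.
move=> i10 i2.
have gap2 : gap i = 2.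
  rewrite /gap /level; suff /eqP-> : trunc_log 2 i - 10 == 0 by [].
  rewrite subn_eq0 ltnW// -(ltn_exp2l _ _ (isT : 1 < 2)).
  by apply: leq_ltn_trans i10; rewrite trunc_logP// (leq_trans _ i2).
have few v : nchildren seed_parents i v < 12.
  rewrite /nchildren -size_filter ltnS.
  apply: (@leq_trans (size (iota v.+1 8))); last by rewrite size_iota.
  apply: uniq_leq_size; first by rewrite filter_uniq// iota_uniq.
  move=> j; rewrite mem_filter !mem_iota => /andP[pj _].
  by have /andP[] := seed_parent_window pj; rewrite addSn ltnS => -> ->.
have [ai bi ab nab far] := seed_far i2; rewrite gap2; split=> //.
  by move=> i10'; rewrite leqNgt i10 in i10'.
move=> [|x [|y [|? ?]]] //=.
  by rewrite andbT => /and3P[_ _ ax] _; apply: contraNneq nab => <-.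
rewrite andbT => /andP[/and3P[_ xi ax] /and3P[_ _ xy]] _.
by apply: contraNneq (far x xi ax) => <-.
Qed.

Lemma exists_parents : exists P : nat -> nat * nat,
  [/\ P 3 = (0, 1), P 4 = (1, 2) & forall n, admissible P n].
Proof.
have [P [P0 gP]] := extend_sequence admissible_local admissible_extend seed_admissible.
by exists P; rewrite !P0.
Qed.

End Parents.

(** * Cycles and levels *)

Section Cycles.
Local Open Scope nat_scope.
Variable P : nat -> nat * nat.
Hypothesis gP : forall n, admissible P n.

Lemma parent_lt u v : parent P u v -> v < u.
Proof.
by case/andP => u2 pv; have [? ? _ _ _] := gP u2; case/orP: pv => /eqP->.
Qed.

Lemma adj_irrefl u : adj P u u = false.
Proof. by rewrite /adj orbb; apply/negP => /parent_lt; rewrite ltnn. Qed.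

Lemma adj_lt_parent u v : adj P u v -> v < u -> parent P u v.
Proof. by case/orP => // /parent_lt uv vu; move: (ltn_trans uv vu); rewrite ltnn. Qed.

Lemma seq_max (c : seq nat) : 0 < size c ->
  exists2 n, n \in c & {in c, forall x, x <= n}.
Proof.
elim: c => [//|x [_ _|y c IH _]].
  by exists x; rewrite ?mem_head// => y; rewrite inE => /eqP ->.
have [//|n nc nmax] := IH; have [xn|nx] := leqP x n.
  exists n => [|z]; first by rewrite in_cons nc orbT.
  by rewrite in_cons => /predU1P[->//|/nmax].
exists x; rewrite ?mem_head// => z; rewrite in_cons => /predU1P[->//|/nmax zn].
exact: leq_trans zn (ltnW nx).
Qed.

(** The two neighbours on the cycle of its largest vertex n are smaller than n, so
they are the two parents of n, and the rest of the cycle is a walk between them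
below n. *)
Lemma cycle_gap (c : seq nat) : uniq c -> cycle (adj P) c -> 2 < size c ->
  exists2 n, {in c, forall x, x <= n} & gap n + 3 <= size c.
Proof.
move=> uc cc c2; have [n nc nmax] := seq_max (ltn_trans (isT : 0 < 2) c2).
exists n => //; have [i c' Ec] := rot_to nc.
have : size (rot i c) = size c by rewrite size_rot.
have : uniq (rot i c) by rewrite rot_uniq.
have : cycle (adj P) (rot i c) by rewrite rot_cycle.
have mx x : x \in c' -> x <= n.
  by move=> xc; apply: nmax; rewrite -(mem_rot i) Ec inE xc orbT.
rewrite Ec; case: c' mx {Ec cc uc nmax} => [|a q] mx; first by move=> ? ? sz; rewrite -sz in c2.
rewrite /= rcons_path => /and3P[na paq bn] /and3P[]; rewrite inE negb_or.
move=> /andP[nea nq] aq _ sz; move: c2; rewrite -sz /= => q0 {nc sz}.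
have lt_n x : x \in a :: q -> x < n.
  move=> xc; rewrite ltn_neqAle mx// andbT; apply: contraTneq xc => ->.
  by rewrite inE negb_or nea nq.
set b := last a q in bn.
have an : a < n by rewrite lt_n ?mem_head.
have bltn : b < n by rewrite lt_n ?mem_last.
move: na bn; rewrite (adjC _ b) => /adj_lt_parent/(_ an) pna /adj_lt_parent/(_ bltn) pnb.
have n2 : 2 < n by case/andP: pna.
have ab : a != b.
  by rewrite /b; case: (q) q0 aq => [//|y s] _; apply: contraNneq => ->; exact: mem_last.
have [_ _ _ _ far] := gP n2.
have {}paq : path (adj_below P n) a q.
  have sub : {in a :: q &, subrel (adj P) (adj_below P n)}.
    by move=> x y xq yq; rewrite /adj_below !lt_n.
  by apply: (sub_in_path sub _ paq); exact/allP.
suff : gap n < size q by rewrite addnS addn2 !ltnS.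
rewrite ltnNge; apply/negP => qn.
move: pna pnb => /andP[_ pa] /andP[_ pb].
(* q runs from the first parent to the second one, or backwards. *)
case/orP: pa => /eqP ea; case/orP: pb => /eqP eb.
- by rewrite ea eb eqxx in ab.
- by move: (far q); rewrite -ea => /(_ paq qn); rewrite -/b eb eqxx.
- have := far (rev (belast a q)); rewrite -eb size_rev size_belast.
  rewrite /b rev_path => /(_ _ qn).
  rewrite (eq_path (e' := adj_below P n)); last first.
    by move=> x y; rewrite /adj_below adjC andbCA andbA [_ && (y < n)]andbC -andbA.
  move=> /(_ paq); rewrite -ea; case: (q) => [|y s]; first by rewrite /= eqxx.
  by rewrite /= rev_cons last_rcons eqxx.
- by rewrite ea eb eqxx in ab.
Qed.

End Cycles.

Section Levels.
Variable P : nat -> nat * nat.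
Hypothesis gP : forall n, admissible P n.

Lemma parent_ge n v : (2 ^ 10 <= n)%N -> parent P n v ->
  (2 ^ (trunc_log 2 n).-1 <= v < 2 ^ trunc_log 2 n)%N.
Proof. by move=> n10 pnv; have [_ _ _ /(_ n10 v pnv)] := gP (andP pnv).1. Qed.

Lemma level_parent n v : parent P n v -> level v = (level n).-1.
Proof.
move=> pnv; have vn := parent_lt gP pnv.
have [n10|n10] := leqP (2 ^ 10) n; last first.
  have lev0 k : (k < 2 ^ 10)%N -> level k = 0%N.
    move=> k10; apply/eqP; rewrite subn_eq0; case: k k10 => [//|k] k10.
    by rewrite ltnW// -(ltn_exp2l _ _ (isT : 1 < 2)%N) (leq_ltn_trans _ k10)// trunc_logP.
  by rewrite !lev0// (ltn_trans vn).
have t10 : (10 <= trunc_log 2 n)%N by rewrite -(@trunc_expnK 2 10 isT) leq_trunc_log.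
have := parent_ge n10 pnv; rewrite /level; case: (trunc_log 2 n) t10 => // t t10 /= tv.
by rewrite (trunc_log_eq (isT : 1 < 2)%N tv); move: t10; clear; lia.
Qed.

(** This makes the graph locally finite. *)
Lemma child_bound n v : parent P n v -> (n < 2 ^ 10 + 4 * v)%N.
Proof.
move=> pnv; have [n10|n10] := leqP (2 ^ 10) n; last by rewrite ltn_addr.
have /andP[vt _] := parent_ge n10 pnv.
have n0 : (0 < n)%N by apply: leq_trans n10.
have /andP[_ nt] := trunc_log_bounds (isT : 1 < 2)%N n0.
have t10 : (10 <= trunc_log 2 n)%N by rewrite -(@trunc_expnK 2 10 isT) leq_trunc_log.
rewrite ltn_addl// (leq_trans nt)//.
apply: (@leq_trans (4 * 2 ^ (trunc_log 2 n).-1)); last by rewrite leq_mul2l.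
by rewrite -[4%N]/(2 ^ 2)%N -expnD leq_exp2l//; move: t10; clear; lia.
Qed.

Lemma parents_neq n : (2 < n)%N -> (P n).1 != (P n).2.
Proof. by move=> n2; have [_ _ _ _ far] := gP n2; apply: (far [::]). Qed.

Lemma level_lt K n : (level n < K)%N -> (n < 2 ^ (K + 10))%N.
Proof.
move=> nK; case: (posnP n) => [->|n0]; first by rewrite expn_gt0.
have /andP[_ nt] := trunc_log_bounds (isT : 1 < 2)%N n0.
by rewrite (leq_trans nt)// leq_exp2l//; move: nK; rewrite /level; lia.
Qed.

Lemma level_exp K : level (2 ^ (K + 10)) = K.
Proof. by rewrite /level trunc_expnK// addnK. Qed.

End Levels.

(** * Arm lengths: square-summable, not summable *)

Section Series.
Context {R : realType}.

(** The constant 17 keeps the arms shorter than pi / 2 and still lets gap n + 3 of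
them add up to 2 pi. *)
Definition level_arm (k : nat) : R := 8 * pi / (k + 17)%:R.

Lemma level_arm_gt0 k : 0 < level_arm k.
Proof. by rewrite divr_gt0 ?mulr_gt0 ?pi_gt0 ?ltr0n ?addn_gt0 ?orbT. Qed.

Lemma level_arm_lt_pihalf k : level_arm k < pi / 2 :> R.
Proof.
have pi0 := pi_gt0 R; rewrite ltr_pdivrMr ?ltr0n ?addn_gt0 ?orbT// natrD.
have := ler0n R k; set m := _%:R => k0; nra.
Qed.

Lemma sin_le_self (x : R) : 0 <= x -> `|sin x| <= x.
Proof.
rewrite le_eqVlt => /predU1P[<-|x0]; first by rewrite sin0 normr0.
have [|c _] := @MVT R (@sin R) (@cos R) 0 x x0 (fun y _ => is_derive_sin y).
  by apply: continuous_subspaceT => y; exact: continuous_sin.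
rewrite sin0 !subr0 => ->; rewrite normrM (gtr0_norm x0) ler_piMl ?(ltW x0)//.
by rewrite ler_norml cos_geN1 cos_le1.
Qed.

Lemma cos_ge (x : R) : 0 <= x -> 1 - x ^+ 2 / 2 <= cos x.
Proof.
move=> x0; rewrite [x in cos x]splitr cosD.
have x2 : 0 <= x / 2 by rewrite divr_ge0.
have := sin_le_self x2; have := cos2sin2 (x / 2).
set s := sin _; set c := cos _ => cs sx.
have : s ^+ 2 <= (x / 2) ^+ 2 by rewrite -real_normK ?num_real// ler_sqr ?nnegrE.
by move: cs; rewrite expr2; lra.
Qed.

Lemma cos_level_arm_gt0 k : 0 < cos (level_arm k : R).
Proof.
apply: cos_gt0_pihalf; rewrite level_arm_lt_pihalf andbT.
by rewrite (lt_trans _ (level_arm_gt0 k))// oppr_lt0 divr_gt0 ?pi_gt0.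
Qed.

(** 1 - cos x is at most x ^ 2 / 2, and 1 / k ^ 2 is dominated by a telescoping
difference. *)
Lemma cos_level_arm_ge : exists2 D : R, 0 < D & forall k, (0 < k)%N ->
  1 - D * (k%:R^-1 - k.+1%:R^-1) <= cos (level_arm k.+1).
Proof.
have [D D0 piD] : exists2 D : R, 0 < D & 8 * pi <= D.
  by exists (8 * pi) => //; rewrite mulr_gt0 ?pi_gt0.
exists (D ^+ 2) => [|k k0]; first by rewrite exprn_gt0.
apply: le_trans (cos_ge (ltW (level_arm_gt0 _))).
rewrite lerD2l lerN2 /level_arm addSn.
set n : R := k%:R; have n0 : 0 < n by rewrite ltr0n.
have -> : k.+1%:R = n + 1 :> R by rewrite -natr1.
have n1 : 0 < n + 1 by rewrite ltr_wpDr.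
have le32 : 8 * pi / (k + 17).+1%:R <= D / (n + 1).
  apply: ler_pM => //; first by rewrite mulr_ge0 ?pi_ge0.
  rewrite lef_pV2 ?posrE ?ltr0n// -addSn natrD -natr1 lerDl.
  exact: ler0n.
have l0 : 0 <= 8 * pi / (k + 17).+1%:R :> R by rewrite divr_ge0 ?mulr_ge0 ?pi_ge0.
have sq : (8 * pi / (k + 17).+1%:R) ^+ 2 <= (D / (n + 1)) ^+ 2.
  by rewrite lerXn2r ?nnegrE// divr_ge0// ltW.
have sq0 : 0 <= (8 * pi / (k + 17).+1%:R) ^+ 2 :> R by rewrite exprn_ge0.
apply: (@le_trans _ _ ((D / (n + 1)) ^+ 2)).
  by apply: le_trans sq; rewrite ler_pdivrMr// ler_peMr// ler1n.
have -> : n^-1 - (n + 1)^-1 = (n * (n + 1))^-1 by field; rewrite !gt_eqF.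
rewrite expr_div_n ler_pM2l ?exprn_gt0// lef_pV2 ?posrE ?exprn_gt0 ?mulr_gt0//.
by rewrite expr2 ler_pM2r// lerDl.
Qed.

(** Beyond some K the remaining factors multiply to at least 1/2. *)
Lemma prod_cos_bounded : exists2 c : R, 0 < c &
  forall k, c <= \prod_(j < k) cos (level_arm j.+1).
Proof.
pose q k : R := \prod_(j < k) cos (level_arm j.+1).
have q0 k : 0 < q k by apply: prodr_gt0 => j _; exact: cos_level_arm_gt0.
have qS k : q k.+1 = q k * cos (level_arm k.+1) by rewrite /q big_ord_recr.
have [D D0 cosD] := cos_level_arm_ge.
have [K K0 Kinv] : exists2 K : nat, (0 < K)%N & D * K%:R^-1 <= 1 / 2.
  pose N := (Num.truncn (2 * D)).+1.
  have N2 : 2 * D < N%:R by exact: truncnS_gt.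
  by exists N => //; rewrite ler_pdivrMr ?ltr0n//; clearbody N; lra.
exists (q K / 2) => [|k]; first by rewrite divr_gt0.
have half : q K / 2 <= q K by rewrite ler_pdivrMr// ler_peMr ?ler1n// ltW.
have [kK|Kk] := leqP k K.
  apply: (le_trans half).
  rewrite -(subnKC kK); elim: (K - k)%N => [|m IH]; first by rewrite addn0.
  by rewrite addnS qS (le_trans _ IH)// ler_piMr ?cos_le1// ltW.
have : q K * (1 - D * (K%:R^-1 - k%:R^-1)) <= q k.
  rewrite -(subnKC (ltnW Kk)); elim: (k - K)%N => [|m IH].
    by rewrite addn0 subrr mulr0 subr0 mulr1.
  rewrite addnS qS; set n := (K + m)%N in IH *.
  have n0 : (0 < n)%N by rewrite addn_gt0 K0.
  have inv0 : n.+1%:R^-1 <= n%:R^-1 :> R.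
    rewrite lef_pV2 ?posrE; [|by rewrite ltr0n|by rewrite ltr0n].
    by rewrite ler_nat.
  have inv1 : n%:R^-1 <= K%:R^-1 :> R.
    rewrite lef_pV2 ?posrE; [|by rewrite ltr0n|by rewrite ltr0n].
    by rewrite ler_nat leq_addr.
  apply: le_trans (ler_wpM2r (ltW (cos_level_arm_gt0 _)) IH).
  rewrite -mulrA ler_pM2l//.
  (* (1 - a)(1 - b) >= 1 - a - b for a, b >= 0 and a <= 1 *)
  have a0 : 0 <= D * (K%:R^-1 - n%:R^-1) by rewrite mulr_ge0 ?subr_ge0// ltW.
  have b0 : 0 <= D * (n%:R^-1 - n.+1%:R^-1) by rewrite mulr_ge0 ?subr_ge0// ltW.
  have D0K : 0 <= D * n%:R^-1 by rewrite mulr_ge0 ?invr_ge0// ltW.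
  have cosn := cosD _ n0.
  have -> : D * (K%:R^-1 - n.+1%:R^-1) =
      D * (K%:R^-1 - n%:R^-1) + D * (n%:R^-1 - n.+1%:R^-1) by ring.
  have a1 : D * (K%:R^-1 - n%:R^-1) <= 1 by rewrite mulrBr; lra.
  move: a0 b0 a1 cosn; set a := D * (K%:R^-1 - _); set b := D * (n%:R^-1 - _); set c := cos _.
  move=> a0 b0 a1 bc.
  have ab := mulr_ge0 a0 b0.
  apply: (@le_trans _ _ ((1 - a) * (1 - b))); first by lra.
  by rewrite ler_wpM2l// subr_ge0.
have k0 : 0 <= D * k%:R^-1 by rewrite mulr_ge0 ?invr_ge0// ltW.
apply: le_trans; rewrite ler_pM2l//.
by rewrite mulrBr; lra.
Qed.

(** The distance from level 0 to level k. *)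
Definition height (k : nat) : R := \sum_(j < k) level_arm j.+1.

Lemma le_height m n : (m <= n)%N -> height m <= height n.
Proof.
move=> mn; rewrite -(subnKC mn) /height big_split_ord /= lerDl sumr_ge0// => j _.
by rewrite ltW// level_arm_gt0.
Qed.

Lemma heightS k : height k.+1 = height k + level_arm k.+1.
Proof. by rewrite /height big_ord_recr. Qed.

Lemma height_unbounded (M : R) : exists k, M < height k.
Proof.
apply: contrapT => /forallNP bnd; apply: (@dvg_harmonic R).
apply: nondecreasing_is_cvgn.
  apply: nondecreasing_series => n _ _; exact: harmonic_ge0.
(* pi >= 2 yields half of the harmonic series. *)
exists (2 * M) => _ [n _ <-]; rewrite /series /=.
have /negP := bnd n; rewrite -leNgt -(ler_pM2l (ltr0n R 2)); apply: le_trans.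
rewrite big_mkord /height mulr_sumr; apply: ler_sum => j _.
rewrite /level_arm /harmonic /=; set x : R := j.+1%:R.
have x1 : 1 <= x by rewrite ler1n.
have -> : (j.+1 + 17)%:R = x + 17 :> R by rewrite natrD.
have x0 : 0 < x by lra.
have x17 : 0 < x + 17 by lra.
rewrite mulrA ler_pdivlMr// mulrC ler_pdivrMr//.
by have := @pihalf_ge1 R; nra.
Qed.

End Series.

(** * Potentials around an edge *)

Section Potentials.
Context {R : realType}.
Variable P : nat -> nat * nat.
Hypothesis gP : forall n, admissible P n.
Implicit Types (x y z u v n : nat) (p q : seq nat).

(** The length of both edges from n to its parents. *)
Definition arm n : R := level_arm (level n).

(** Of two adjacent vertices the larger one is the child. *)
Definition weight u v : R := arm (maxn u v).

Fixpoint walk_length u p : R :=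
  if p is v :: q then weight u v + walk_length v q else 0.

Lemma arm_gt0 n : 0 < arm n. Proof. exact: level_arm_gt0. Qed.

Lemma arm_lt_pihalf n : arm n < pi / 2. Proof. exact: level_arm_lt_pihalf. Qed.

Lemma le_arm m n : (m <= n)%N -> arm n <= arm m.
Proof.
move=> mn; rewrite ler_wpM2l ?mulr_ge0 ?pi_ge0// lef_pV2 ?posrE ?ltr0n ?addn_gt0 ?orbT//.
by rewrite ler_nat leq_add2r leq_sub2r// leq_trunc_log.
Qed.

Lemma gap_arm n : 2 * pi <= (gap n + 3)%:R * arm n.
Proof.
have pi0 := pi_gt0 R.
rewrite mulrA ler_pdivlMr ?ltr0n ?addn_gt0 ?orbT//.
have : (level n + 17 <= 4 * (gap n + 3))%N.
  rewrite /gap; have := divn_eq (level n) 4; have := ltn_pmod (level n) (isT : 0 < 4)%N.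
  by lia.
rewrite -(ler_nat R) natrM => h.
have -> : (gap n + 3)%:R * (8 * pi) = 2 * pi * (4 * (gap n + 3)%:R) :> R by ring.
by rewrite ler_wpM2l ?mulr_ge0 ?pi_ge0.
Qed.

Lemma weightC u v : weight u v = weight v u.
Proof. by rewrite /weight maxnC. Qed.

Lemma weight_gt0 u v : 0 < weight u v. Proof. exact: arm_gt0. Qed.

Lemma walk_length_ge0 u p : 0 <= walk_length u p.
Proof. by elim: p u => //= v p IH u; rewrite addr_ge0// ltW// weight_gt0. Qed.

Lemma walk_length_cat u p q :
  walk_length u (p ++ q) = walk_length u p + walk_length (last u p) q.
Proof. by elim: p u => [|v p IH] u /=; rewrite ?add0r// IH addrA. Qed.

(** Cutting out the loops. *)
Lemma simplify_walk (e : rel nat) u p : path e u p ->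
  exists q, [/\ path e u q, last u q = last u p, uniq (u :: q)
             & walk_length u q <= walk_length u p].
Proof.
elim: p u => [|v p IH] u; first by exists [::].
rewrite [path _ _ _]/= => /andP[uv /IH[q [vq lq uq wq]]].
have [uin|unin] := boolP (u \in v :: q); last first.
  by exists (v :: q); rewrite /= uv vq unin; split=> //; rewrite lerD2l.
move: uin vq lq uq wq; rewrite inE => /predU1P[->|uin] vq lq uq wq.
  by exists q; split=> //=; rewrite (le_trans wq)// lerDr ltW// weight_gt0.
case/splitPr: uin vq lq uq wq => q1 q2.
rewrite cat_path last_cat -cat_cons cat_uniq walk_length_cat.
move=> /andP[_ /= /andP[_ uq2]] lq /and3P[_ _ uuq] wq.
exists q2; split=> //; rewrite (le_trans _ (le_trans wq _))//=; last first.
  by rewrite lerDr ltW// weight_gt0.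
by rewrite addrA lerDr addr_ge0 ?walk_length_ge0// ltW// weight_gt0.
Qed.

Lemma walk_length_ge n u p : (u <= n)%N -> {in p, forall x, x <= n}%N ->
  (size p)%:R * arm n <= walk_length u p.
Proof.
elim: p u => [|v p IH] u un pn /=; first by rewrite mul0r.
have vn : (v <= n)%N by rewrite pn ?mem_head.
rewrite -add1n natrD mulrDl mul1r lerD//.
  by rewrite le_arm// geq_max un.
by apply: IH => // x xp; rewrite pn// in_cons xp orbT.
Qed.

Definition avoid x y u v :=
  adj P u v && ~~ ((u == x) && (v == y) || (u == y) && (v == x)).

Lemma avoid_adj x y : subrel (avoid x y) (adj P).
Proof. by move=> u v /andP[]. Qed.

Lemma avoidC x y u v : avoid x y u v = avoid x y v u.
Proof. by rewrite /avoid adjC; congr (_ && ~~ _); rewrite orbC andbC [(u == x) && _]andbC. Qed.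

(** Without loops, the walk closes up with the edge xy to a simple cycle, all edges
of which are at least as long as the arm of its largest vertex. *)
Lemma detour_length x y p : adj P x y -> path (avoid x y) x p -> last x p = y ->
  2 * pi - weight x y <= walk_length x p.
Proof.
move=> axy /simplify_walk[q [xq lq uq wq]] lp; apply: le_trans wq.
rewrite lp in lq; move: axy xq lq uq; case: q => [|v [|v' q]].
- by move=> + _ /= xy _; rewrite xy (adj_irrefl gP).
- by move=> _ /= /andP[/andP[_ av] _] vy _; rewrite vy !eqxx in av.
move: (v :: _) (isT : 1 < size [:: v, v' & q])%N => {v v'}q q1 axy xq lq uq.
have [] := @cycle_gap P gP (x :: q).
- by [].
- rewrite /= rcons_path lq adjC axy andbT.
  by apply: sub_path xq; exact: avoid_adj.
- by [].
move=> n nmax ngap; rewrite lerBlDr.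
apply: le_trans (gap_arm n) _.
apply: (@le_trans _ _ ((size q).+1%:R * arm n)).
  by rewrite ler_wpM2r ?(ltW (arm_gt0 _))// ler_nat.
rewrite -addn1 natrD mulrDl mul1r lerD//.
  by apply: walk_length_ge => [|z zq]; rewrite nmax ?mem_head// in_cons zq orbT.
rewrite le_arm// geq_max nmax ?mem_head//= nmax// -lq.
exact: mem_last.
Qed.

Lemma weight_le_using x z u p : path (adj P) u p -> ~~ path (avoid x z) u p ->
  weight x z <= walk_length u p.
Proof.
elim: p u => [//|v p IH] u /= /andP[uv vp]; rewrite negb_and => /orP[|nvp]; last first.
  by rewrite (le_trans (IH _ vp nvp))// lerDr ltW// weight_gt0.
rewrite /avoid uv /= negbK => /orP[] /andP[/eqP-> /eqP->].
  by rewrite lerDl walk_length_ge0.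
by rewrite weightC lerDl walk_length_ge0.
Qed.

Section OneEdge.
Variables x y : nat.
Hypothesis xy : adj P x y.

Let K : R := 2 * pi - weight x y.

Let reach_lengths v : set R := [set l | l = K \/
  exists p, [/\ path (avoid x y) x p, last x p = v & walk_length x p = l]].

Let K_ge w : weight x w <= K.
Proof.
have := arm_lt_pihalf (maxn x y); have := arm_lt_pihalf (maxn x w); have := pi_gt0 R.
by rewrite /K /weight; lra.
Qed.

Let lengths_ge0 v : lbound (reach_lengths v) 0.
Proof.
move=> _ [->|[p [_ _ <-]]]; last exact: walk_length_ge0.
by apply: le_trans (K_ge y); rewrite ltW// weight_gt0.
Qed.

Let inf_le v l : reach_lengths v l -> inf (reach_lengths v) <= l.
Proof. by apply: ge_inf; exists 0; exact: lengths_ge0. Qed.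

Let le_inf_ v l : lbound (reach_lengths v) l -> l <= inf (reach_lengths v).
Proof. by apply: lb_le_inf; exists K; left. Qed.

(** g is the distance from x in the graph without the edge xy, truncated at
2 pi - weight x y. Read modulo 2 pi, as a map to the circle of length 2 pi, it
is 1-Lipschitz on the whole graph. The last clause holds because a walk from x to
z either uses the edge xz or is a detour for it. *)
Lemma edge_potential : exists g : nat -> R,
  [/\ g x = 0, g y = 2 * pi - weight x y,
      forall v, 0 <= g v <= 2 * pi - weight x y,
      forall u v, avoid x y u v -> `|g u - g v| <= weight u v
    & forall z, adj P x z -> z != y -> g z = weight x z].
Proof.
exists (fun v => inf (reach_lengths v)); split.
- apply/eqP; rewrite eq_le le_inf_// andbT; apply: inf_le.
  by right; exists [::].
- apply/eqP; rewrite eq_le inf_le; last by left.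
  apply: le_inf_ => _ [->//|[p [xp lp <-]]]; exact: detour_length.
- by move=> v; rewrite le_inf_//= inf_le//; left.
- have half u v : avoid x y u v ->
      inf (reach_lengths v) - inf (reach_lengths u) <= weight u v.
    move=> uv; rewrite lerBlDl -lerBlDr; apply: le_inf_ => _ [->|[p [xp lp <-]]].
      rewrite lerBlDr; apply: (@le_trans _ _ K); first by apply: inf_le; left.
      by rewrite lerDl ltW// weight_gt0.
    rewrite lerBlDr; apply: inf_le; right; exists (rcons p v).
    by rewrite rcons_path xp lp uv last_rcons -cats1 walk_length_cat/= lp addr0.
  move=> u v uv; rewrite ler_norml; apply/andP; split.
    by rewrite lerNl opprB half.
  by rewrite weightC half// avoidC.
move=> z xz zy; apply/eqP; rewrite eq_le; apply/andP; split.
  apply: inf_le; right; exists [:: z]; rewrite /= addr0 andbT; split=> //.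
  by rewrite /avoid xz eqxx (negbTE zy) /=; apply/negP => /andP[_ /eqP zx]; move: xz; rewrite zx (adj_irrefl gP).
apply: le_inf_ => _ [->|[p [xp lp <-]]]; first exact: K_ge.
have xp' : path (adj P) x p by apply: sub_path xp; exact: avoid_adj.
have [av|] := boolP (path (avoid x z) x p); last exact: weight_le_using.
apply: le_trans (detour_length xz av lp); rewrite lerBrDr.
by have := arm_lt_pihalf (maxn x z); have := pi_gt0 R; rewrite /weight; lra.
Qed.

End OneEdge.

End Potentials.

(** * The metric space of a weighted graph *)

(** Connectedness is expressed by saying that a nonempty union of components is the
whole graph. *)
Record graph_data (R : realType) := GraphData {
  gvertex : choiceType ;
  gedge : choiceType ;
  gsrc : gedge -> gvertex ;
  gtgt : gedge -> gvertex ;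
  glen : gedge -> R ;
  glen_gt0 : forall e, 0 < glen e ;
  gfinite : forall v, finite_set [set e | gsrc e = v \/ gtgt e = v] ;
  gconnected : forall S : set gvertex, S !=set0 ->
    (forall e, S (gsrc e) <-> S (gtgt e)) -> forall v, S v
}.

Inductive point (R : realType) (G : graph_data R) :=
| at_vertex (v : gvertex G)
| on_edge (e : gedge G) (t : R) (t_in : 0 < t < glen e).

HB.instance Definition _ (R : realType) (G : graph_data R) := gen_eqMixin (point G).
HB.instance Definition _ (R : realType) (G : graph_data R) := gen_choiceMixin (point G).

Section Realization.
Context {R : realType} {G : graph_data R}.
Implicit Types (x y z : point G) (v : gvertex G) (e : gedge G) (s t l r : R).

(** Only the values for t in [0, glen e] matter. *)
Definition param e t : point G :=
  match @idP (0 < t < glen e) with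
  | ReflectT h => on_edge h
  | ReflectF _ => if t <= 0 then at_vertex (gsrc e) else at_vertex (gtgt e)
  end.

Lemma param_inner e t (h : 0 < t < glen e) : param e t = on_edge h.
Proof.
rewrite /param; case: {-}_ / idP => [h'|//].
by rewrite (bool_irrelevance h' h).
Qed.

Lemma param0 e : param e 0 = at_vertex (gsrc e).
Proof. by rewrite /param; case: {-}_ / idP => [h|_]; [exfalso; move: h; rewrite ltxx|rewrite lexx]. Qed.

Lemma param_len e : param e (glen e) = at_vertex (gtgt e).
Proof.
rewrite /param; case: {-}_ / idP => [h|_]; first by exfalso; move: h; rewrite ltxx andbF.
by rewrite leNgt glen_gt0.
Qed.

Definition glue (g : gvertex G -> R) (k : gedge G -> R -> R) x : R :=
  match x with
  | at_vertex v => g v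
  | on_edge e t _ => k e t
  end.

Lemma itv_edge_cases e t : t \in `[0, glen e] ->
  [\/ t = 0, t = glen e | 0 < t < glen e].
Proof.
rewrite in_itv/= => /andP[]; rewrite le_eqVlt => /predU1P[<-|t0]; first by constructor 1.
rewrite le_eqVlt => /predU1P[->|tl]; first by constructor 2.
by constructor 3; rewrite t0.
Qed.

Lemma glue_param g k e t : k e 0 = g (gsrc e) -> k e (glen e) = g (gtgt e) ->
  t \in `[0, glen e] -> glue g k (param e t) = k e t.
Proof.
move=> k0 kl /itv_edge_cases[->|->|h]; rewrite ?param0 ?param_len//.
by rewrite (param_inner h).
Qed.

(** Such functions do not increase distances ([graph_dist_lipschitz]); as distances
are infima, all lower bounds for them are obtained in this way. *)
Definition edge_lipschitz (f : point G -> R) :=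
  forall e s t, s \in `[0, glen e] -> t \in `[0, glen e] ->
    `|f (param e s) - f (param e t)| <= `|s - t|.

Lemma glue_lipschitz g k :
  (forall e, k e 0 = g (gsrc e)) -> (forall e, k e (glen e) = g (gtgt e)) ->
  (forall e s t, s \in `[0, glen e] -> t \in `[0, glen e] ->
    `|k e s - k e t| <= `|s - t|) ->
  edge_lipschitz (glue g k).
Proof. by move=> k0 kl lip e s t si ti; rewrite !glue_param//; exact: lip. Qed.

Local Notation chain := (chain (@glen R G) param).

Lemma chain_lipschitz f x y l : edge_lipschitz f -> chain x y l ->
  `|f x - f y| <= l.
Proof.
move=> lip; elim=> [{}x|e s t {}y {}l si ti _ IH]; first by rewrite subrr normr0.
by rewrite (le_trans (ler_distD (f (param e t)) _ _))// lerD// lip.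
Qed.

Lemma chain_ge0 x y l : chain x y l -> 0 <= l.
Proof.
by move=> /(@chain_lipschitz (cst 0)); rewrite subrr normr0; apply=> e s t _ _;
  rewrite subrr normr0.
Qed.

Lemma chain_cat x y z l l' : chain x y l -> chain y z l' -> chain x z (l + l').
Proof.
elim=> [{}x|e s t {}y {}l si ti _ IH] yz; first by rewrite add0r.
by rewrite -addrA; apply: chain_cons => //; exact: IH.
Qed.

Lemma chain_step e s t : s \in `[0, glen e] -> t \in `[0, glen e] ->
  chain (param e s) (param e t) `|s - t|.
Proof. by move=> si ti; rewrite -[`|_|]addr0; apply: chain_cons => //; exact: chain_nil. Qed.

Lemma chain_rev x y l : chain x y l -> chain y x l.
Proof.
elim=> [{}x|e s t {}y {}l si ti _ IH]; first exact: chain_nil.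
by rewrite addrC distrC; apply: chain_cat IH _; exact: chain_step.
Qed.

Lemma edge0_in e : 0 \in `[0, glen e].
Proof. by rewrite in_itv/= lexx ltW ?glen_gt0. Qed.

Lemma edge_len_in e : glen e \in `[0, glen e].
Proof. by rewrite in_itv/= lexx ltW ?glen_gt0. Qed.

Lemma edge_inner_in e t : 0 < t < glen e -> t \in `[0, glen e].
Proof. by move=> /andP[? ?]; rewrite in_itv/= !ltW. Qed.

Lemma chain_exists x y : exists l, chain x y l.
Proof.
have to_vertex z : exists v l, chain z (at_vertex v) l.
  case: z => [v|e t h]; first by exists v, 0; exact: chain_nil.
  exists (gsrc e), `|t - 0|; rewrite -(param_inner h) -param0.
  by apply: chain_step (edge0_in _); exact: edge_inner_in.
have [u [lx xu]] := to_vertex x; have [v [ly yv]] := to_vertex y.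
have edge_chain e : exists l, chain (at_vertex (gsrc e)) (at_vertex (gtgt e)) l.
  exists `|0 - glen e|; rewrite -param0 -param_len.
  exact: chain_step (edge0_in e) (edge_len_in e).
suff [l uv] : exists l, chain (at_vertex u) (at_vertex v) l.
  exists (lx + (l + ly)); apply: chain_cat xu _; apply: chain_cat uv _.
  exact: chain_rev.
apply: (@gconnected _ G [set w | exists l, chain (at_vertex u) (at_vertex w) l]).
  by exists u; exists 0; exact: chain_nil.
move=> e; have [l el] := edge_chain e; split=> -[l' ul'].
  by exists (l' + l); exact: chain_cat ul' el.
by exists (l' + l); apply: chain_cat ul' _; exact: chain_rev.
Qed.

Definition graph_dist x y : R := inf [set l | chain x y l].

Let has_inf_chain x y : has_inf [set l | chain x y l].
Proof.
by split; [have [l xy] := chain_exists x y; exists l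
          |exists 0 => l; exact: chain_ge0].
Qed.

Lemma graph_dist_le_chain x y l : chain x y l -> graph_dist x y <= l.
Proof. by move=> xy; apply: ge_inf => //; have [] := has_inf_chain x y. Qed.

Lemma le_graph_dist x y r : (forall l, chain x y l -> r <= l) -> r <= graph_dist x y.
Proof. by move=> h; apply: lb_le_inf => //; have [] := has_inf_chain x y. Qed.

Lemma graph_dist_lt x y r : graph_dist x y < r -> exists2 l, chain x y l & l < r.
Proof. by move=> /inf_lt[|l xy lr]; [have [] := has_inf_chain x y|exists l]. Qed.

Lemma graph_dist_lipschitz f x y : edge_lipschitz f -> `|f x - f y| <= graph_dist x y.
Proof. by move=> lip; apply: le_graph_dist => l; exact: chain_lipschitz. Qed.

Lemma graph_dist_param_le e s t : s \in `[0, glen e] -> t \in `[0, glen e] ->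
  graph_dist (param e s) (param e t) <= `|s - t|.
Proof. by move=> si ti; apply: graph_dist_le_chain; exact: chain_step. Qed.

Definition interpolate (g : gvertex G -> R) : point G -> R :=
  glue g (fun e t => g (gsrc e) + t / glen e * (g (gtgt e) - g (gsrc e))).

Lemma interpolate_param g e t : t \in `[0, glen e] ->
  interpolate g (param e t) = g (gsrc e) + t / glen e * (g (gtgt e) - g (gsrc e)).
Proof.
apply: glue_param; first by rewrite !mul0r addr0.
by rewrite divff ?gt_eqF ?glen_gt0// mul1r addrC subrK.
Qed.

Lemma interpolate_step g e s t :
  `|g (gsrc e) - g (gtgt e)| <= glen e ->
  `|(g (gsrc e) + s / glen e * (g (gtgt e) - g (gsrc e))) -
    (g (gsrc e) + t / glen e * (g (gtgt e) - g (gsrc e)))| <= `|s - t|.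
Proof.
move=> ge; rewrite opprD addrACA subrr add0r -mulrBl -mulrBl normrM normrM.
rewrite normfV (gtr0_norm (glen_gt0 e)) -mulrA ler_piMr// mulrC ler_pdivrMr ?glen_gt0//.
by rewrite mul1r distrC.
Qed.

Lemma interpolate_lipschitz g :
  (forall e, `|g (gsrc e) - g (gtgt e)| <= glen e) -> edge_lipschitz (interpolate g).
Proof.
by move=> ge e s t si ti; rewrite !interpolate_param// interpolate_step.
Qed.

(** Separates the point at s0 on e0 from all other points. *)
Definition bump e0 s0 r : point G -> R :=
  glue (cst 0) (fun e t => if e == e0 then Num.max 0 (r - `|t - s0|) else 0).

Lemma dist_max0 a b : `|Num.max 0 a - Num.max 0 b| <= `|a - b| :> R.
Proof.
have := ler_norm (a - b); have := ler_norm (b - a); rewrite [`|b - a|]distrC.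
by case: (lerP 0 a) => ha; case: (lerP 0 b) => hb ab ba; rewrite ler_norml; lra.
Qed.

Lemma bump_lipschitz e0 s0 r : r <= s0 -> r <= glen e0 - s0 -> edge_lipschitz (bump e0 s0 r).
Proof.
move=> rs rl; apply: glue_lipschitz => [e|e|e s t _ _]; case: eqP => [ee|_] //=.
- by rewrite sub0r normrN max_l// subr_le0 (le_trans rs)// ler_norm.
- by rewrite ee max_l// subr_le0 (le_trans rl)// ler_norm.
- apply: le_trans (dist_max0 _ _) _.
  have -> : r - `|s - s0| - (r - `|t - s0|) = `|t - s0| - `|s - s0| by ring.
  apply: le_trans (ler_dist_dist _ _) _.
  have -> : t - s0 - (s - s0) = - (s - t) by ring.
  by rewrite normrN.
- by rewrite subrr normr0.
Qed.

Lemma bump_gt0 e0 s0 r y : 0 < bump e0 s0 r y -> exists t,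
  [/\ 0 < t < glen e0, y = param e0 t, `|t - s0| < r & bump e0 s0 r y = r - `|t - s0|].
Proof.
case: y => [v|e t h] /=; first by rewrite ltxx.
case: eqP => [ee|_]; last by rewrite ltxx.
rewrite lt_max ltxx/= subr_gt0 => tr; exists t; rewrite -ee (param_inner h) max_r//.
by rewrite subr_ge0 ltW.
Qed.

Lemma bump_param e0 s0 r t : 0 < t < glen e0 ->
  bump e0 s0 r (param e0 t) = Num.max 0 (r - `|t - s0|).
Proof. by move=> h; rewrite (param_inner h) /=; case: eqP. Qed.

(** Separates v from the other vertices. *)
Definition vertex_bump v r : point G -> R :=
  interpolate (fun u => if u == v then 0 else r).

(** By local finiteness the edges at v are not arbitrarily short. *)
Lemma vertex_bump_lipschitz v : exists2 r, 0 < r & edge_lipschitz (vertex_bump v r).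
Proof.
have [r r0 rmin] : exists2 r, 0 < r & forall e, gsrc e = v \/ gtgt e = v -> r <= glen e.
  have /finite_seqP[s sE] := @gfinite _ G v.
  have [r r0 rs] : exists2 r, 0 < r & forall e, e \in s -> r <= glen e.
    elim: (s) => [|e s' [r r0 IH]]; first by exists 1.
    exists (Num.min r (glen e)); first by rewrite lt_min r0 glen_gt0.
    by move=> f; rewrite in_cons ge_min => /predU1P[->|/IH->//]; rewrite lexx orbT.
  exists r => // e ev; apply: rs.
  by have : [set` s] e by rewrite -sE.
exists r => //; apply: interpolate_lipschitz => e.
case: eqP => [eu|_]; case: eqP => [ev|_].
- by rewrite subrr normr0 ltW ?glen_gt0.
- by rewrite sub0r normrN gtr0_norm// rmin//; left.
- by rewrite subr0 gtr0_norm// rmin//; right.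
- by rewrite subrr normr0 ltW ?glen_gt0.
Qed.

Let graph_distxx x : graph_dist x x = 0.
Proof.
apply/eqP; rewrite eq_le graph_dist_le_chain /=; last exact: chain_nil.
by apply: le_graph_dist => l; exact: chain_ge0.
Qed.

Let graph_dist_sym x y : graph_dist x y = graph_dist y x.
Proof.
suff h (a b : point G) : graph_dist a b <= graph_dist b a by apply/eqP; rewrite eq_le !h.
by apply: le_graph_dist => l /chain_rev; exact: graph_dist_le_chain.
Qed.

Let graph_dist_triangle y x z : graph_dist x z <= graph_dist x y + graph_dist y z.
Proof.
rewrite -lerBlDr; apply: le_graph_dist => l xy; rewrite lerBlDr -lerBlDl.
apply: le_graph_dist => l' yz; rewrite lerBlDl; apply: graph_dist_le_chain.
exact: chain_cat yz.
Qed.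

Let graph_dist_separated x y f : edge_lipschitz f -> graph_dist x y = 0 -> f x = f y.
Proof.
move=> lip xy; apply/eqP; rewrite -subr_eq0 -normr_le0 -xy.
exact: graph_dist_lipschitz.
Qed.

Let graph_dist_inner e t (h : 0 < t < glen e) y :
  graph_dist (on_edge h) y = 0 -> on_edge h = y.
Proof.
have /andP[t0 tl] := h; pose r := Num.min t (glen e - t).
have r0 : 0 < r by rewrite lt_min t0 subr_gt0.
have lip : edge_lipschitz (bump e t r).
  by apply: bump_lipschitz; rewrite ge_min lexx ?orbT.
move=> /(graph_dist_separated lip); rewrite -(param_inner h) bump_param// subrr normr0 subr0.
rewrite max_r ?ltW// => rE.
have by0 : 0 < bump e t r y by move: r0; rewrite [X in 0 < X -> _]rE.
have [s [hs ys _ bE]] := bump_gt0 by0.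
have : `|s - t| = 0 by move: bE; rewrite -rE; lra.
by rewrite ys => /normr0P/eqP/subr0_eq => ->.
Qed.

Let graph_dist_positivity x y : graph_dist x y = 0 -> x = y.
Proof.
case: x => [v|e t h]; last exact: graph_dist_inner.
case: y => [u|e t h]; last by rewrite graph_dist_sym => /graph_dist_inner.
have [r r0 lip] := vertex_bump_lipschitz v.
move=> /(graph_dist_separated lip); rewrite /vertex_bump /= eqxx.
by case: eqP => [->//|_ /eqP]; rewrite lt_eqF.
Qed.

HB.instance Definition _ := isMetric.Build R (point G)
  graph_distxx graph_dist_positivity graph_dist_sym graph_dist_triangle.

Lemma mdistE x y : mdist x y = graph_dist x y. Proof. by []. Qed.

Definition realization_vertex : set (point G) := range (@at_vertex R G).

Definition realization_graph : metric_graph (point G).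
Proof.
refine (@MetricGraph R (point G) realization_vertex (gedge G) (@glen R G) param
  _ _ _ _ _ _ _ _ _).
- exact: glen_gt0.
- by move=> e; rewrite param0; exists (gsrc e).
- by move=> e; rewrite param_len; exists (gtgt e).
- by move=> e t; rewrite in_itv/= => h; rewrite (param_inner h) => -[].
- move=> e e' s t; rewrite !in_itv/= => hs ht.
  by rewrite (param_inner hs) (param_inner ht) => -[-> ->].
- case=> [v|e t h]; first by left; exists v.
  by right; exists e; exists t; rewrite ?in_itv ?param_inner.
- move=> _ [v _ <-]; apply: sub_finite_set (@gfinite _ G v) => e /=.
  by rewrite param0 param_len => -[[->]|[->]]; [left|right].
- exact: chain_exists.
- by [].
Defined.

End Realization.

(** * Properness *)

Section MetricBasics.
Context {R : realType} {Y : metricType R}.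
Implicit Types (c : R -> Y) (a b s t : R).

Lemma nbhs_mdist (y : Y) (A : set Y) :
  nbhs y A <-> exists2 e, 0 < e & forall z, mdist y z < e -> A z.
Proof.
split=> [/nbhs_ballP[e /= e0 eA]|[e e0 eA]]; last first.
  by apply/nbhs_ballP; exists e => //= z; rewrite ballEmdist; exact: eA.
by exists e => // z yz; apply: eA; rewrite ballEmdist.
Qed.

Lemma within_continuousP a b c : {within `[a, b], continuous c} <->
  forall t, t \in `[a, b] -> forall e, 0 < e -> exists2 d, 0 < d &
    forall s, s \in `[a, b] -> `|t - s| < d -> mdist (c t) (c s) < e.
Proof.
split=> [/subspace_continuousP cc t tab e e0|cc].
  have /cc : [set` `[a, b]] t by [].
  have ne : nbhs (c t) [set z | mdist (c t) z < e] by apply/nbhs_mdist; exists e.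
  move=> /(_ _ ne) /nbhs_ballP[d /= d0 dP]; exists d => // s sab ts.
  exact: (dP s).
apply/subspace_continuousP => t tab A /nbhs_mdist[e e0 eA].
have [d d0 dP] := cc t tab e e0.
by apply/nbhs_ballP; exists d => //= s ts sab; apply: eA; exact: dP.
Qed.

Lemma closed_mdist_le (x : Y) (r : R) : closed [set y | mdist x y <= r].
Proof.
rewrite -openC openE => y /= /negP; rewrite -ltNge => ry.
apply/nbhs_mdist; exists (mdist x y - r); rewrite ?subr_gt0// => z yz /=.
apply/negP; rewrite -ltNge; have := metric_triangle x z y.
by rewrite (metric_sym z y); lra.
Qed.

End MetricBasics.

Section Proper.
Context {R : realType} {G : graph_data R}.

Lemma param_continuous (e : gedge G) : {within `[0, glen e], continuous (@param R G e)}.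
Proof.
apply/within_continuousP => t ti eps e0; exists eps => // s si ts.
by apply: le_lt_trans ts; exact: graph_dist_param_le.
Qed.

(** A closed ball lies in a sublevel set of the interpolation of g, which meets
finitely many closed edges only. *)
Lemma realization_proper (g : gvertex G -> R) :
  (forall e, `|g (gsrc e) - g (gtgt e)| <= glen e) ->
  (forall r, finite_set [set v | g v <= r]) ->
  proper_space (point G).
Proof.
move=> glip gfin x r.
pose M := interpolate g x + r.
pose V := [set v | g v <= M].
pose E := [set e | V (gsrc e) \/ V (gtgt e)].
have Efin : finite_set E.
  apply: (@sub_finite_set _ _ (\bigcup_(v in V) [set e | gsrc e = v \/ gtgt e = v])).
    by move=> e [ve|ve]; [exists (gsrc e)|exists (gtgt e)] => //=; [left|right].
  by apply: bigcup_finite => [|v _]; [exact: gfin|exact: gfinite].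
have /finite_seqP[s sE] := Efin.
pose K := \big[setU/set0]_(e <- s) (param e @` `[0, glen e]).
apply: (@subclosed_compact _ _ (@at_vertex R G @` V `|` K)).
- exact: closed_mdist_le.
- apply: compactU.
    by apply: finite_compact; apply: finite_image; exact: gfin.
  apply: bigsetU_compact => e _; apply: continuous_compact (@segment_compact _ _ _).
  exact: param_continuous.
move=> y /= xy.
have yM : interpolate g y <= M.
  have := graph_dist_lipschitz x y (interpolate_lipschitz glip).
  rewrite distrC => /(le_trans (ler_norm _)); rewrite -mdistE /M.
  by move: xy; lra.
case: y {xy} yM => [v|e t h] yM; first by left; exists v.
right; rewrite /K -bigcup_seq; exists e; last first.
  by exists t; [exact: edge_inner_in|exact: param_inner].
have : E e.
  apply: contrapT => /not_orP[/negP + /negP]; rewrite -!ltNge => h0 h1.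
  move: yM; rewrite /interpolate /= leNgt => /negP; apply.
  have /andP[t0 tl] := h; set k := t / glen e.
  have k0 : 0 < k by rewrite divr_gt0 ?glen_gt0.
  have k1 : k < 1 by rewrite ltr_pdivrMr ?glen_gt0// mul1r.
  have p0 : 0 < (1 - k) * (g (gsrc e) - M) by rewrite mulr_gt0 ?subr_gt0.
  have p1 : 0 < k * (g (gtgt e) - M) by rewrite mulr_gt0 ?subr_gt0.
  by move: p0 p1; clearbody M k; lra.
by rewrite sE.
Qed.

End Proper.

(** * Girth *)

(** The supremum m of the points to which a is related is again related to a, and
if m < b it could be passed. *)
Lemma creep (R : realType) (a b : R) (P : R -> R -> Prop) : a <= b ->
  (forall t, P t t) -> (forall r s t, P r s -> P s t -> P r t) ->
  (forall t, t \in `[a, b] -> exists2 d, 0 < d &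
    forall s, s \in `[a, b] -> `|t - s| < d ->
      (s <= t -> P s t) /\ (t <= s -> P t s)) ->
  P a b.
Proof.
move=> ab P0 Ptr Ploc.
pose S := [set t | t \in `[a, b] /\ P a t].
have Sa : S a by split=> //; rewrite in_itv/= lexx.
have Sub : ubound S b by move=> t []; rewrite in_itv/= => /andP[].
have hS : has_sup S by split; [exists a|exists b].
set m := sup S.
have am : a <= m by apply: ub_le_sup => //; exists b.
have mb : m <= b by apply: ge_sup => //; exists a.
have mab : m \in `[a, b] by rewrite in_itv/= am.
have [d d0 dP] := Ploc m mab.
have [s [sab Ps] ms] : exists2 s, S s & m - d < s by apply: sup_adherent.
have sm : s <= m by apply: ub_le_sup; [exists b|split].
have Pm : P a m.
  apply: Ptr Ps _; apply: (dP s sab _).1 => //.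
  by rewrite ger0_norm ?subr_ge0// ltrBlDr -ltrBlDl.
move: mb; rewrite le_eqVlt => /predU1P[<-//|mb].
pose t := Num.min b (m + d / 2).
have mt : m < t by rewrite lt_min mb ltrDl divr_gt0.
have tab : t \in `[a, b] by rewrite in_itv/= (le_trans am (ltW mt)) ge_min lexx.
have : t <= m.
  apply: ub_le_sup; first by exists b.
  split=> //; apply: Ptr Pm _; apply: (dP t tab _).2; last exact: ltW.
  rewrite ltr0_norm ?subr_lt0// opprB ltrBlDl gt_min; apply/orP; right.
  by rewrite ltrD2l ltr_pdivrMr// ltr_pMr// ltr1n.
by rewrite leNgt mt.
Qed.

Lemma opposite_ends (R : realType) (L eta x a b m p q : R) :
  a < eta /\ L - eta < b \/ L - eta < a /\ b < eta ->
  `|x - a| <= p -> `|x - b| <= q -> 0 <= m -> L - 2 * eta <= p + (m + q).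
Proof.
have := ler_norm (x - a); have := ler_norm (a - x); rewrite [`|a - x|]distrC.
have := ler_norm (x - b); have := ler_norm (b - x); rewrite [`|b - x|]distrC.
by move=> ? ? ? ? [] [? ?] ? ? ?; lra.
Qed.

Section CutLength.
Context {R : realType} {Y : metricType R}.
Variable c : R -> Y.

Fixpoint polygon_length (t : R) (s : seq R) : R :=
  if s is u :: s' then mdist (c t) (c u) + polygon_length u s' else 0.

Lemma polygon_length_cat t s s' :
  polygon_length t (s ++ s') = polygon_length t s + polygon_length (last t s) s'.
Proof. by elim: s t => [|u s IH] t /=; rewrite ?add0r// IH addrA. Qed.

Lemma polygon_lengthE b t s : polygon_length t s =
  \sum_(0 <= n < size s) mdist ((c \o nth b (t :: s)) n) ((c \o nth b (t :: s)) n.+1).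
Proof.
elim: s t => [|u s IH] t /=; first by rewrite big_geq.
by rewrite big_nat_recl//= IH.
Qed.

Lemma polygon_le_curve_length a b s : itv_partition a b s ->
  ((polygon_length a s)%:E <= curve_length a b c)%E.
Proof.
move=> abs; apply: ereal_sup_ubound; exists s => //.
by rewrite (polygon_lengthE b).
Qed.

Variables (z : Y) (F : Y -> R) (L kappa t0 : R).
Hypotheses (cc : simple_closed_curve c) (t01 : 0 < t0 < 1) (ct0 : c t0 = z).
Hypothesis kappa0 : 0 < kappa.
Hypothesis F_local : forall x y, mdist x y < mdist x z -> `|F x - F y| <= mdist x y.
Hypothesis F_ends : forall eta, 0 < eta -> exists2 eps, 0 < eps &
  forall x, x != z -> mdist x z < eps -> F x < eta \/ L - eta < F x.
Hypothesis F_itv : forall x, x != z -> 0 < F x < L.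
Hypothesis F_injl : forall x y, x != z -> y != z -> F x = F y -> F x < kappa -> x = y.
Hypothesis F_injr : forall x y, x != z -> y != z -> F x = F y -> L - kappa < F x -> x = y.

Let curve_ne t : t \in `[0, 1] -> t != t0 -> c t != z.
Proof.
have [_ c01 cinj] := cc; have /andP[t00 t0l] := t01.
have t0i : t0 \in `[0, 1[ by rewrite in_itv/= ltW.
rewrite in_itv/= => /andP[t_0]; rewrite le_eqVlt => /predU1P[->|t1] tt0; apply/eqP.
  rewrite -c01 -ct0 => /cinj; rewrite in_itv/= lexx ltr01 => /(_ isT t0i) e.
  by rewrite -e ltxx in t00.
rewrite -ct0 => /cinj; rewrite in_itv/= t_0 t1 => /(_ isT t0i) e.
by rewrite e eqxx in tt0.
Qed.

Let piece (a b : R) := {subset `[a, b] <= `[0, 1]} /\ t0 \notin `[a, b].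

Let piece_ne a b t : piece a b -> t \in `[a, b] -> c t != z.
Proof.
by move=> [sub nt0] tab; apply: curve_ne (sub _ tab) _; apply: contraNneq nt0 => <-.
Qed.

Let local_lip a b t : piece a b -> t \in `[a, b] -> exists2 d, 0 < d &
  forall s, s \in `[a, b] -> `|t - s| < d ->
    `|F (c t) - F (c s)| <= mdist (c t) (c s).
Proof.
move=> pab tab; have [/within_continuousP cont _ _] := cc.
have cz0 : 0 < mdist (c t) z by rewrite mdist_gt0; exact: piece_ne pab tab.
have [d d0 dP] := cont t (pab.1 _ tab) _ cz0.
exists d => // s sab ts; apply: F_local; apply: dP => //; exact: pab.1.
Qed.

Let piece_length a b : a <= b -> piece a b -> exists2 s, itv_partition a b s &
  `|F (c a) - F (c b)| <= polygon_length a s.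
Proof.
move=> ab pab.
apply: (@creep R a b (fun a b => exists2 s, itv_partition a b s &
  `|F (c a) - F (c b)| <= polygon_length a s)) => //.
- by move=> t; exists [::]; [split=> /=|rewrite subrr normr0].
- move=> r s t [p rs pr] [q st qs]; exists (p ++ q).
    exact: itv_partition_cat rs st.
  have [_ /eqP lp] := rs.
  rewrite polygon_length_cat lp (le_trans (ler_distD (F (c s)) _ _))// lerD//.
move=> t tab; have [d d0 dP] := local_lip pab tab; exists d => // s sab ts.
have h := dP s sab ts; split; rewrite le_eqVlt => /predU1P[->|lt];
  try by exists [::]; [split=> /=|rewrite subrr normr0].
- exists [:: t]; first exact: itv_partition1.
  by rewrite /= addr0 distrC metric_sym.
- exists [:: s]; first exact: itv_partition1.
  by rewrite /= addr0.
Qed.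

Let piece_continuous a b : piece a b -> {within `[a, b], continuous (F \o c)}.
Proof.
move=> pab; have [/within_continuousP cont _ _] := cc.
apply/subspace_continuousP => t tab; apply/cvgrPdist_lt => e e0.
have [d d0 dP] := local_lip pab tab.
have [d' d'0 dP'] := cont t (pab.1 _ tab) e e0.
rewrite near_withinE; apply/nbhs_ballP; exists (Num.min d d').
  by rewrite /= lt_min d0.
move=> s; rewrite /ball/= lt_min => /andP[sd sd'] sab /=.
by rewrite (le_lt_trans (dP s sab sd))// dP'// pab.1.
Qed.

Let pieceL t1 : 0 <= t1 < t0 -> piece 0 t1.
Proof.
move=> /andP[t10 t1t]; have /andP[t00 t0l] := t01; split.
  by move=> s; rewrite !in_itv/= => /andP[-> /le_trans]; apply; lra.
by rewrite in_itv/= negb_and -!ltNge t1t orbT.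
Qed.

Let pieceR t2 : t0 < t2 <= 1 -> piece t2 1.
Proof.
move=> /andP[t10 t1t]; have /andP[t00 t0l] := t01; split.
  by move=> s; rewrite !in_itv/= => /andP[s1 ->]; rewrite andbT; lra.
by rewrite in_itv/= negb_and -!ltNge t10.
Qed.

(** If the curve were on the side of z with small values of f both before and after
t0, then f, which takes the same value at the times 0 and 1, would take a common
value below m on both sides of t0, and the curve would have a double point. *)
Let opposite_sides (f : Y -> R) m t1 t2 :
  (forall a b, piece a b -> {within `[a, b], continuous (f \o c)}) ->
  (forall x y, x != z -> y != z -> f x = f y -> f x < m -> x = y) ->
  0 <= t1 < t0 -> t0 < t2 <= 1 -> m <= f (c 0) ->
  f (c t1) < m -> f (c t2) < m -> False.
Proof.
move=> fcont finj t1i t2i m0 m1 m2; have [_ c01 cinj] := cc.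
have pl := pieceL t1i; have pr := pieceR t2i.
move: t1i t2i => /andP[t10 t1t] /andP[tt2 t21].
pose v := Num.max (f (c t1)) (f (c t2)).
have vm : v < m by rewrite gt_max m1.
have [|s1 s1i s1v] := @IVT R (f \o c) 0 t1 v t10 (fcont _ _ pl).
  by rewrite /= ge_min le_max !le_max !lexx (ltW (lt_le_trans vm m0)) /= !orbT.
have [|s2 s2i s2v] := @IVT R (f \o c) t2 1 v t21 (fcont _ _ pr).
  by rewrite /= -c01 ge_min le_max !le_max !lexx (ltW (lt_le_trans vm m0)) /= !orbT.
have e : c s1 = c s2.
  apply: finj; [exact: piece_ne s1i|exact: piece_ne s2i| |].
    by move: s1v s2v => /= -> ->.
  by move: s1v => /= ->.
have /andP[t00 t0l] := t01.
move: s1i s2i; rewrite !in_itv/= => /andP[s10 s1t1] /andP[s2t2].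
rewrite le_eqVlt => /predU1P[s21|s21].
  move: s2v; rewrite s21 /= -c01 => v0.
  by move: (lt_le_trans vm m0); rewrite v0 ltxx.
have : s1 = s2 by apply: cinj => //; rewrite in_itv/=; apply/andP; split=> //; lra.
lra.
Qed.

(** F measures how far one has come from one side of z to the other one in Y cut at
z. The curve leaves z on one side and returns on the other, so F varies by
almost L on the rest of it, and F is locally 1-Lipschitz there. *)
Lemma cut_length : (L%:E <= curve_length 0 1 c)%E.
Proof.
have [/within_continuousP cont c01 cinj] := cc; have /andP[t00 t0l] := t01.
have z0 : c 0 != z by apply: curve_ne; rewrite ?in_itv/= ?lexx ?ler01// lt_eqF.
have /andP[F0 F0L] := F_itv z0.
suff approx eta : 0 < eta -> eta <= kappa -> eta <= F (c 0) -> eta <= L - F (c 0) ->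
    ((L - 2 * eta)%:E <= curve_length 0 1 c)%E.
  apply/lee_addgt0Pr => e e0.
  pose eta := Num.min (Num.min (e / 2) kappa) (Num.min (F (c 0)) (L - F (c 0))).
  have e2 : eta <= e / 2 by rewrite /eta !ge_min lexx.
  have ek : eta <= kappa by rewrite /eta !ge_min lexx !orbT.
  have ef : eta <= F (c 0) by rewrite /eta !ge_min lexx !orbT.
  have eF : eta <= L - F (c 0) by rewrite /eta !ge_min lexx !orbT.
  have : ((L - 2 * eta)%:E <= curve_length 0 1 c)%E.
    apply: approx => //.
    by rewrite !lt_min F0 kappa0 divr_gt0// subr_gt0.
  move=> h; rewrite -leeBlDr//; apply: le_trans h.
  by rewrite -EFinB lee_fin; lra.
move=> eta0 etak eta1 eta2.
have [eps eps0 epsP] := F_ends eta0.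
have t0i : t0 \in `[0, 1] by rewrite in_itv/= !ltW.
have [d d0 dP] := cont t0 t0i eps eps0.
(* t1 and t2 are so close to t0 that F is within eta of 0 or L there. *)
pose del := Num.min (d / 2) (Num.min t0 (1 - t0)).
have del0 : 0 < del by rewrite !lt_min divr_gt0// t00 subr_gt0.
have deld : del < d by rewrite gt_min ltr_pdivrMr// ltr_pMr// ltr1n.
have delt : del <= t0 by rewrite !ge_min lexx orbT.
have delt' : del <= 1 - t0 by rewrite !ge_min lexx !orbT.
pose t1 := t0 - del; pose t2 := t0 + del.
have t1i : 0 <= t1 < t0 by rewrite subr_ge0 delt ltrBlDr ltrDl.
have t2i : t0 < t2 <= 1 by rewrite ltrDl del0 -lerBrDl.
have /andP[t10 t1t] := t1i; have /andP[tt2 t21] := t2i.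
have near t : t \in `[0, 1] -> t != t0 -> `|t0 - t| < d ->
    F (c t) < eta \/ L - eta < F (c t).
  move=> ti tt0 td; apply: epsP; first exact: curve_ne.
  by rewrite metric_sym -ct0; exact: dP.
have t1i' : t1 \in `[0, 1] by rewrite in_itv/= t10 ltW// (lt_trans t1t).
have t1n : t1 != t0 by rewrite lt_eqF.
have n1 : F (c t1) < eta \/ L - eta < F (c t1).
  apply: near => //.
  by rewrite /t1 opprB addrC subrK gtr0_norm.
have t2i' : t2 \in `[0, 1] by rewrite in_itv/= t21 ltW// (lt_trans t00).
have t2n : t2 != t0 by rewrite gt_eqF.
have n2 : F (c t2) < eta \/ L - eta < F (c t2).
  apply: near => //.
  by rewrite /t2 opprD addrA subrr sub0r normrN gtr0_norm.
have [p1 p1i p1l] := piece_length t10 (pieceL t1i).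
have [p2 p2i p2l] := piece_length t21 (pieceR t2i).
have pi : itv_partition 0 1 (p1 ++ [:: t2] ++ p2).
  apply: itv_partition_cat p1i _; apply: itv_partition_cat p2i.
  by apply: itv_partition1; exact: lt_trans tt2.
apply: le_trans (polygon_le_curve_length pi); rewrite lee_fin.
have [_ /eqP l1] := p1i.
rewrite polygon_length_cat /= l1.
have Lcont a b : piece a b -> {within `[a, b], continuous ((fun x => L - F x) \o c)}.
  move=> /piece_continuous Fc t.
  exact: (@continuousB _ _ _ (cst L : subspace `[a, b] -> R) (F \o c) t (@cst_continuous _ _ _ _) (Fc t)).
have := mdist_ge0 (c t1) (c t2).
move: p1l p2l; rewrite -c01 [`|F (c t2) - _|]distrC => p1l p2l m0.
have swap x e : L - e < F x <-> L - F x < e by rewrite ltrBlDr -ltrBlDl.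
case: n1 n2 => [n1|n1] [n2|n2].
- by case: (@opposite_sides F eta t1 t2); auto; move=> x y xz yz xy xe; apply: F_injl => //; apply: lt_le_trans xe _.
- by apply: opposite_ends p1l p2l m0; left.
- by apply: opposite_ends p1l p2l m0; right.
- case: (@opposite_sides (fun x => L - F x) eta t1 t2) => //; try exact/swap.
  move=> x y xz yz /addrI/oppr_inj xy xe; apply: F_injr => //.
  by apply/swap; exact: lt_le_trans xe etak.
Qed.

End CutLength.

Section GraphGirth.
Context {R : realType} {G : graph_data R}.
Implicit Types (x y : point G) (e : gedge G).

Lemma edge_lipschitz_continuous (f : point G -> R) (c : R -> point G) (a b : R) :
  edge_lipschitz f -> {within `[a, b], continuous c} ->
  {within `[a, b], continuous (f \o c)}.
Proof.
move=> lip /within_continuousP cont.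
apply/subspace_continuousP => t tab; apply/cvgrPdist_lt => e e0.
have [d d0 dP] := cont t tab e e0.
rewrite near_withinE; apply/nbhs_ballP; exists d => //= s sd sab.
by apply: le_lt_trans (graph_dist_lipschitz _ _ lip) _; exact: dP.
Qed.

(** On vertices [vertex_bump] takes two values only, so a path from one vertex to
another attains the mean of these two values inside an edge. *)
Lemma simple_closed_curve_inner (c : R -> point G) : simple_closed_curve c ->
  exists e t s, [/\ 0 < t < 1, 0 < s < glen e & c t = param e s].
Proof.
move=> [cont _ cinj].
have c12 : c (1 / 3) != c (2 / 3).
  apply/eqP => /cinj; rewrite !in_itv/= => h.
  have : 1 / 3 = 2 / 3 :> R by apply: h; lra.
  by lra.
suff [t [t13 [e [s [h cE]]]]] : exists t, 1 / 3 <= t <= 2 / 3 /\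
    exists e s, exists h : 0 < s < glen e, c t = on_edge h.
  by exists e, t, s; rewrite h (param_inner h); split=> //; lra.
case c1 : (c (1 / 3)) => [v|e s h]; last first.
  by exists (1 / 3); split; [lra|exists e, s, h].
case c2 : (c (2 / 3)) => [u|e s h]; last first.
  by exists (2 / 3); split; [lra|exists e, s, h].
have uv : u != v by apply: contraNneq c12 => e; rewrite c1 c2 e.
have [r r0 lip] := vertex_bump_lipschitz v.
have fcont : {within `[1 / 3, 2 / 3], continuous (vertex_bump v r \o c)}.
  apply: edge_lipschitz_continuous => //; apply: continuous_subspaceW cont.
  by move=> t /=; rewrite !in_itv/=; lra.
have [|//|t tI] := @IVT R _ (1 / 3) (2 / 3) (r / 2) _ fcont.
- by clear; lra.
- rewrite /= c1 c2 /= eqxx (negbTE uv) ge_min le_max; apply/andP; split; apply/orP.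
    by left; rewrite divr_ge0 ?ltW.
  by right; move: r0; clear; lra.
move=> /=; case ct : (c t) => [w|e s h].
  by rewrite /=; case: eqP => _ h; move: r0 h; clear; lra.
by move=> _; exists t; split; [move: tI; rewrite in_itv|exists e, s, h].
Qed.

Variable L : R.
Hypothesis potential : forall e0, exists g : gvertex G -> R,
  [/\ g (gsrc e0) = 0, g (gtgt e0) = L - glen e0,
      forall v, 0 <= g v <= L - glen e0
    & forall e, e != e0 -> `|g (gsrc e) - g (gtgt e)| <= glen e].

Section Cut.
Variables (e0 : gedge G) (s0 : R) (g : gvertex G -> R).
Hypothesis s0i : 0 < s0 < glen e0.
Hypothesis g_src : g (gsrc e0) = 0.
Hypothesis g_tgt : g (gtgt e0) = L - glen e0.
Hypothesis g_itv : forall v, 0 <= g v <= L - glen e0.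
Hypothesis g_lip : forall e, e != e0 -> `|g (gsrc e) - g (gtgt e)| <= glen e.

(** The point at s0 of e0 is removed. The function grows from 0 to L on the way from
there to the source of e0, through the rest of the graph following g, and back
along e0 from its target. *)
Let cut_edge e t : R := if e == e0 then if t <= s0 then s0 - t else L - t + s0
  else s0 + (g (gsrc e) + t / glen e * (g (gtgt e) - g (gsrc e))).

Let cut : point G -> R := glue (fun v => s0 + g v) cut_edge.

Let z := param e0 s0.

Let s0_gt0 : 0 < s0. Proof. by case/andP: s0i. Qed.
Let s0_lt : s0 < glen e0. Proof. by case/andP: s0i. Qed.
Let len_le : glen e0 <= L. Proof. by have := g_itv (gsrc e0); lra. Qed.

Let cut_param e t : t \in `[0, glen e] -> cut (param e t) = cut_edge e t.
Proof.
apply: glue_param; rewrite /cut_edge; case: eqP => [->|_].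
- by rewrite ltW// g_src; lra.
- by rewrite !mul0r addr0.
- by rewrite leNgt s0_lt /= g_tgt; lra.
- by rewrite divff ?gt_eqF ?glen_gt0//; lra.
Qed.

Let cut_step e s t : s \in `[0, glen e] -> t \in `[0, glen e] ->
  `|cut (param e s) - cut (param e t)| <= `|s - t| \/
  mdist (param e s) z <= `|s - t|.
Proof.
move=> si ti; rewrite !cut_param// /cut_edge.
have [ee|ne] := eqVneq e e0; last first.
  by left; rewrite opprD addrACA subrr add0r interpolate_step// g_lip.
rewrite ee in si ti *.
have near_z : `|s - s0| <= `|s - t| -> mdist (param e0 s) z <= `|s - t|.
  by apply: le_trans; apply: graph_dist_param_le => //; exact: edge_inner_in.
have [ss|ss] := leP s s0; have [ts|ts] := leP t s0.
- by left; rewrite distrC; have -> : s0 - t - (s0 - s) = s - t by ring.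
- by right; apply: near_z; rewrite !ler0_norm; lra.
- by right; apply: near_z; rewrite !ger0_norm; lra.
- by left; rewrite distrC; have -> : L - t + s0 - (L - s + s0) = s - t by ring.
Qed.

(** A chain along which the function jumps passes through the removed point. *)
Let cut_chain x y l : chain (@glen R G) param x y l ->
  `|cut x - cut y| <= l \/ mdist x z <= l.
Proof.
elim=> [{}x|e s t {}y {}l si ti ch IH]; first by left; rewrite subrr normr0.
have l0 := chain_ge0 ch.
have [st|st] := cut_step si ti; last by right; lra.
case: IH => IH; [left|right].
  by rewrite (le_trans (ler_distD (cut (param e t)) _ _))// lerD.
rewrite (le_trans (metric_triangle _ (param e t) _))// lerD//.
exact: graph_dist_param_le.
Qed.

Let cut_local x y : mdist x y < mdist x z -> `|cut x - cut y| <= mdist x y.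
Proof.
move=> xyz; rewrite leNgt; apply/negP => xy.
have : mdist x y < Num.min `|cut x - cut y| (mdist x z) by rewrite lt_min xy.
move=> /graph_dist_lt[l /cut_chain h]; rewrite lt_min => /andP[l1 l2].
by case: h; rewrite leNgt ?l1 ?l2.
Qed.

Let cut_cases x : x != z ->
  [\/ exists t, [/\ 0 < t < s0, x = param e0 t & cut x = s0 - t],
      exists t, [/\ s0 < t < glen e0, x = param e0 t & cut x = L - t + s0]
    | s0 <= cut x <= s0 + (L - glen e0)].
Proof.
case: x => [v|e t h] xz.
  by constructor 3; rewrite /cut/=; have := g_itv v; lra.
have tx : on_edge h = param e t by rewrite (param_inner h).
have [ee|ne] := eqVneq e e0; last first.
  constructor 3; rewrite /cut/= /cut_edge (negbTE ne).
  have /andP[t0 tl] := h; set k := t / glen e.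
  have k0 : 0 < k by rewrite divr_gt0 ?glen_gt0.
  have k1 : k < 1 by rewrite ltr_pdivrMr ?glen_gt0// mul1r.
  have := g_itv (gsrc e); have := g_itv (gtgt e).
  set a := g (gsrc e); set b := g (gtgt e) => /andP[b0 b1] /andP[a0 a1].
  have p0 : 0 <= (1 - k) * a by rewrite mulr_ge0// subr_ge0 ltW.
  have p1 : 0 <= k * b by rewrite mulr_ge0// ltW.
  have p2 : 0 <= (1 - k) * (L - glen e0 - a) by rewrite mulr_ge0// subr_ge0// ltW.
  have p3 : 0 <= k * (L - glen e0 - b) by rewrite mulr_ge0 ?subr_ge0// ltW.
  by move: p0 p1 p2 p3; clearbody k a b; lra.
move: xz; rewrite tx ee => xz.
have /andP[t0 tl] := h; rewrite ee in tl.
have ti : t \in `[0, glen e0] by rewrite in_itv/= !ltW.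
rewrite cut_param// /cut_edge eqxx.
have [ts|ts|ts] := ltgtP t s0.
- by constructor 1; exists t; rewrite t0.
- by constructor 2; exists t; rewrite ts.
- by rewrite ts eqxx in xz.
Qed.

Lemma cut_edge_length c t0 : simple_closed_curve c -> 0 < t0 < 1 -> c t0 = z ->
  (L%:E <= curve_length 0 1 c)%E.
Proof.
move=> cc t01 ct0.
have a0 : 0 < s0 := s0_gt0.
have a1 : s0 < glen e0 := s0_lt.
have a2 : glen e0 <= L := len_le.
pose r := Num.min s0 (glen e0 - s0).
have r0 : 0 < r by rewrite lt_min s0_gt0 subr_gt0.
have [rs rl] : r <= s0 /\ r <= glen e0 - s0 by rewrite !ge_min !lexx orbT.
apply: (@cut_length _ _ c z cut L r t0) => //.
- move=> eta eta0; exists (Num.min eta r); first by rewrite lt_min eta0.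
  move=> x xz; rewrite lt_min => /andP[xe xr].
  have lip : edge_lipschitz (bump e0 s0 r) by exact: bump_lipschitz.
  have := graph_dist_lipschitz x z lip.
  rewrite {2}/z bump_param// subrr normr0 subr0 max_r ?(ltW r0)// -mdistE distrC.
  move=> /(le_trans (ler_norm _)) bx.
  have /bump_gt0[t [ti xE _ bE]] : 0 < bump e0 s0 r x by lra.
  have ts : `|t - s0| < eta by lra.
  rewrite xE cut_param ?edge_inner_in// /cut_edge eqxx.
  move: ts; rewrite ltr_norml => /andP[ts1 ts2].
  have [ts|ts] := leP t s0; [left|right].
    by lra.
  by lra.
- by move=> x /cut_cases[[t [? _ ->]]|[t [? _ ->]]|]; lra.
- move=> x y /cut_cases[[t [ti -> ->]]|[t [ti _ ->]]|?]; try by move=> _ _ ?; exfalso; lra.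
  move=> /cut_cases[[t' [ti' -> ->]]|[t' [ti' _ ->]]|?]; try by move=> ? ?; exfalso; lra.
  by move=> e _; congr param; lra.
- move=> x y /cut_cases[[t [ti _ ->]]|[t [ti -> ->]]|?]; try by move=> _ _ ?; exfalso; lra.
  move=> /cut_cases[[t' [ti' _ ->]]|[t' [ti' -> ->]]|?]; try by move=> ? ?; exfalso; lra.
  by move=> e _; congr param; lra.
Qed.

End Cut.

(** A curve is cut at an inner point of an edge e0; the potential bounds the length
of the way around e0. *)
Lemma realization_girth : (L%:E <= girth (point G))%E.
Proof.
apply/ereal_infP => _ [c cc <-].
have [e [t [s [ti si ct]]]] := simple_closed_curve_inner cc.
have [g [g0 g1 gi gl]] := potential e.
exact: (cut_edge_length si g0 g1 gi gl cc ti ct).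
Qed.

End GraphGirth.

(** * Convex sets in a cone *)

Section ConeConvexity.
Context {R : realType} {Y : metricType R}.
Implicit Types (y z : Y) (r s t p a b x : R) (gamma : R -> Y).

(** The tip is given the radius 0. *)
Definition polar r y : cone R Y :=
  match @idP (0 < r) with ReflectT r0 => cone_pt r r0 y | ReflectF _ => tip end.

Lemma polar_pos r (r0 : 0 < r) y : polar r y = cone_pt r r0 y.
Proof.
rewrite /polar; case: {-}_ / idP => [h|//].
by rewrite (bool_irrelevance h r0).
Qed.

Lemma polar0 y : polar 0 y = tip.
Proof. by rewrite /polar; case: {-}_ / idP => // h; exfalso; rewrite ltxx in h. Qed.

Lemma polar_mdist r s y z : 0 <= r -> 0 <= s ->
  mdist (polar r y) (polar s z) =
  Num.sqrt (r ^+ 2 + s ^+ 2 - 2 * r * s * cos (Num.min pi (mdist y z))).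
Proof.
rewrite !le_eqVlt => /predU1P[<-|r0] /predU1P[<-|s0].
- rewrite !polar0 mdistxx [X in Num.sqrt X](_ : _ = 0) ?sqrtr0//; ring.
- rewrite polar0 (polar_pos s0) [X in Num.sqrt X](_ : _ = s ^+ 2); last by ring.
  by rewrite sqrtr_sqr gtr0_norm.
- rewrite polar0 (polar_pos r0) [X in Num.sqrt X](_ : _ = r ^+ 2); last by ring.
  by rewrite sqrtr_sqr gtr0_norm.
- by rewrite (polar_pos r0) (polar_pos s0).
Qed.

Lemma polar_mdist_ray r s y : 0 <= r -> 0 <= s ->
  mdist (polar r y) (polar s y) = `|r - s|.
Proof.
move=> r0 s0; rewrite polar_mdist// mdistxx min_r ?pi_ge0// cos0 -sqrtr_sqr.
by congr Num.sqrt; ring.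
Qed.

Lemma polar_mdist_opposite r s y z : pi <= mdist y z -> 0 <= r -> 0 <= s ->
  mdist (polar r y) (polar s z) = r + s.
Proof.
move=> yz r0 s0; rewrite polar_mdist// min_l// cospi.
rewrite -[RHS]ger0_norm ?addr_ge0// -sqrtr_sqr.
by congr Num.sqrt; ring.
Qed.

Variable C : set (cone R Y).
Hypothesis convC : geodesically_convex C.

Lemma geodesic_mem (l : R) (g : R -> cone R Y) t : geodesic l g ->
  C (g 0) -> C (g l) -> t \in `[0, l] -> C (g t).
Proof.
move=> gg g0 gl tl; apply: (convC g0 gl); exists l, g; split=> //.
by exists t.
Qed.

(** Over points at distance at least pi, the two radii form a geodesic. *)
Lemma tip_mem r s y z : 0 < r -> 0 < s -> pi <= mdist y z ->
  C (polar r y) -> C (polar s z) -> C tip.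
Proof.
move=> r0 s0 yz Cy Cz; have zy : pi <= mdist z y by rewrite metric_sym.
pose g x := if x <= r then polar (r - x) y else polar (x - r) z.
have := @geodesic_mem (r + s) g r; rewrite /g lexx subrr polar0; apply.
- split=> [|u v]; first by rewrite addr_ge0// ltW.
  rewrite !in_itv/= => /andP[u0 us] /andP[v0 vs].
  have [ur|ur] := leP u r; have [vr|vr] := leP v r.
  + by rewrite polar_mdist_ray ?subr_ge0// distrC; congr `|_|; ring.
  + by rewrite polar_mdist_opposite ?subr_ge0 ?(ltW vr)// ler0_norm ?subr_le0 ?(le_trans ur (ltW vr))//; ring.
  + by rewrite polar_mdist_opposite ?subr_ge0 ?(ltW ur)// ger0_norm ?subr_ge0 ?(le_trans vr (ltW ur))//; ring.
  + by rewrite polar_mdist_ray ?subr_ge0 ?ltW//; congr `|_|; ring.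
- by rewrite (ltW r0) subr0.
- by rewrite leNgt ltrDl s0 /= addrC addKr.
- by rewrite in_itv/= (ltW r0) lerDl ltW.
Qed.

Lemma ray_mem r s y : C tip -> 0 <= s <= r -> C (polar r y) -> C (polar s y).
Proof.
move=> C0 /andP[s0 sr] Cr; have r0 := le_trans s0 sr.
apply: (@geodesic_mem r (polar^~ y)) => //.
- split=> // u v; rewrite !in_itv/= => /andP[u0 _] /andP[v0 _].
  exact: polar_mdist_ray.
- by rewrite polar0.
- by rewrite in_itv/= s0.
Qed.

Definition isometric_on gamma a b := {in `[a, b] &, forall s t,
  mdist (gamma s) (gamma t) = `|s - t|}.

(** In the flat sector over gamma, the points with angle t and radius p / cos t form
the line at distance p from the tip; its arc length is p * tan t. *)
Lemma chord_mem p gamma a b t : 0 < p -> - (pi / 2) < a -> b < pi / 2 ->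
  isometric_on gamma a b -> t \in `[a, b] ->
  C (polar (p / cos a) (gamma a)) -> C (polar (p / cos b) (gamma b)) ->
  C (polar (p / cos t) (gamma t)).
Proof.
move=> p0 api bpi iso tab Ca Cb.
have pi0 := pi_gt0 R.
have in_pihalf s : s \in `[a, b] -> - (pi / 2) < s < pi / 2.
  by rewrite in_itv/= => /andP[sa sb]; rewrite (lt_le_trans api sa) (le_lt_trans sb bpi).
have in_pihalf' s : s \in `[a, b] -> s \in `]- (pi / 2), (pi / 2)[.
  by rewrite in_itv/=; exact: in_pihalf.
have cpos s : s \in `[a, b] -> 0 < cos s by move=> /in_pihalf; exact: cos_gt0_pihalf.
have ab : a <= b by move: tab; rewrite in_itv/= => /andP[]; exact: le_trans.
have aab : a \in `[a, b] by rewrite in_itv/= lexx.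
have bab : b \in `[a, b] by rewrite in_itv/= lexx ab.
have le_tan u v : u \in `[a, b] -> v \in `[a, b] -> u <= v -> tan u <= tan v.
  move=> ui vi; rewrite le_eqVlt => /predU1P[->//|uv]; apply: ltW.
  by rewrite ltr_tan ?in_pihalf'.
pose psi x := atan (x / p + tan a).
pose g x := polar (p / cos (psi x)) (gamma (psi x)).
pose coord s := p * (tan s - tan a).
have psi_coord s : s \in `[a, b] -> psi (coord s) = s.
  move=> si; rewrite /psi /coord mulrC mulKf ?gt_eqF// subrK.
  by rewrite tanK// in_pihalf'.
have g_coord s : s \in `[a, b] -> g (coord s) = polar (p / cos s) (gamma s).
  by move=> si; rewrite /g psi_coord.
have coord_itv s : s \in `[a, b] -> coord s \in `[0, coord b].
  move=> si; have := si; rewrite in_itv/= => /andP[sa sb].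
  by rewrite in_itv/= mulr_ge0 ?(ltW p0) ?subr_ge0 ?le_tan//= ler_pM2l// lerD2r le_tan.
have psi_itv x : x \in `[0, coord b] -> psi x \in `[a, b].
  rewrite !in_itv/= => /andP[x0 xb]; apply/andP; split.
    rewrite -[leLHS](tanK (in_pihalf' _ aab)) /psi; apply: le_atan.
    by rewrite lerDr divr_ge0// ltW.
  rewrite -[leRHS](tanK (in_pihalf' _ bab)) /psi; apply: le_atan.
  by rewrite -lerBrDr ler_pdivrMr// mulrC.
rewrite -g_coord//; apply: (@geodesic_mem (coord b)).
- split=> [|u v ui vi]; first by have := coord_itv _ bab; rewrite in_itv/= => /andP[].
  have uE : u = coord (psi u).
    by rewrite /coord /psi atanK addrK mulrC divfK ?gt_eqF.
  have vE : v = coord (psi v).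
    by rewrite /coord /psi atanK addrK mulrC divfK ?gt_eqF.
  have su := psi_itv _ ui; have sv := psi_itv _ vi.
  rewrite [in RHS]uE [in RHS]vE /g.
  move: (psi u) (psi v) su sv => {uE vE} m n mi ni.
  have cm := cpos _ mi; have cn := cpos _ ni.
  rewrite polar_mdist ?divr_ge0 ?(ltW p0) ?(ltW cm) ?(ltW cn)// iso//.
  rewrite min_r; last first.
    have /andP[m1 m2] := in_pihalf _ mi; have /andP[n1 n2] := in_pihalf _ ni.
    by rewrite ler_norml; lra.
  rewrite cos_norm cosB -sqrtr_sqr; congr Num.sqrt.
  rewrite /coord /tan.
  have cm0 : cos m != 0 by rewrite gt_eqF.
  have cn0 : cos n != 0 by rewrite gt_eqF.
  have ca0 : cos a != 0 by rewrite gt_eqF// cpos.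
  have em := cos2Dsin2 m; have en := cos2Dsin2 n.
  rewrite [X in _ = X ^+ 2](_ : _ = p * (sin m / cos m - sin n / cos n)); last by ring.
  rewrite expr_div_n expr_div_n.
  have -> : p ^+ 2 / cos m ^+ 2 = p ^+ 2 * (1 + (sin m / cos m) ^+ 2).
    by rewrite -{1}[p ^+ 2]mulr1 -{1}em; field.
  have -> : p ^+ 2 / cos n ^+ 2 = p ^+ 2 * (1 + (sin n / cos n) ^+ 2).
    by rewrite -{1}[p ^+ 2]mulr1 -{1}en; field.
  by field; rewrite cn0 cm0.
- by rewrite /g /psi mul0r add0r tanK ?in_pihalf'.
- by rewrite g_coord.
- exact: coord_itv.
Qed.

(** With two different radii the line is the same up to a rotation by the angle phi
of the foot of the perpendicular from the tip. *)
Lemma chord_mem_pos r s gamma theta t : 0 < r -> 0 < s -> 0 < theta < pi ->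
  isometric_on gamma 0 theta -> t \in `[0, theta] ->
  C (polar r (gamma 0)) -> C (polar s (gamma theta)) ->
  exists2 rho, 0 < rho & C (polar rho (gamma t)).
Proof.
move=> r0 s0 thi iso ti Cr Cs; have pi0 := pi_gt0 R.
have /andP[th0 thpi] := thi; have sth := sin_gt0_pi thi.
(* phi solves r * cos phi = s * cos (theta - phi), the distance of the line. *)
pose phi := atan ((r - s * cos theta) / (s * sin theta)).
have phi_gt : - (pi / 2) < phi := atan_gtNpi2 _.
have phi_lt : phi < pi / 2 := atan_ltpi2 _.
have cphi : 0 < cos phi by apply: cos_gt0_pihalf; rewrite phi_gt.
have sinphi : sin phi = cos phi * ((r - s * cos theta) / (s * sin theta)).
  have := atanK ((r - s * cos theta) / (s * sin theta)).
  by rewrite -/phi => <-; rewrite /tan mulrC divfK// gt_eqF.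
have cE : s * cos (theta - phi) = r * cos phi.
  rewrite cosB sinphi; field.
  by rewrite !gt_eqF.
have cth : 0 < cos (theta - phi).
  by rewrite -(pmulr_rgt0 _ s0) cE mulr_gt0.
have th_lt : theta - phi < pi / 2.
  rewrite ltNge; apply/negP => h.
  have : 0 <= sin (theta - phi - pi / 2).
    have [->|ne] := eqVneq (theta - phi - pi / 2) 0; first by rewrite sin0.
    apply/ltW/sin_gt0_pi; rewrite lt_neqAle eq_sym ne /= subr_ge0 h /=.
    by move: thpi phi_gt; lra.
  have -> : sin (theta - phi - pi / 2) = - cos (theta - phi).
    by rewrite -[in RHS](subrK (pi / 2) (theta - phi)) cosDpihalf opprK.
  by rewrite oppr_ge0 leNgt cth.
have tphi : t - phi \in `[- phi, theta - phi].
  by move: ti; rewrite !in_itv/= => /andP[t_0 t_1]; apply/andP; split; lra.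
have ct : 0 < cos (t - phi).
  apply: cos_gt0_pihalf; move: ti; rewrite in_itv/= => /andP[t0 tth].
  by apply/andP; split; lra.
exists (r * cos phi / cos (t - phi)); first by rewrite divr_gt0 ?mulr_gt0.
have := @chord_mem (r * cos phi) (fun x => gamma (x + phi)) (- phi) (theta - phi) (t - phi).
rewrite /= !subrK addNr cosN mulfK ?gt_eqF// -cE mulfK ?gt_eqF//; apply => //.
- by rewrite mulr_gt0.
- by rewrite ltrN2.
- move=> u v; rewrite !in_itv/= => /andP[u0 u1] /andP[v0 v1].
  by rewrite iso ?in_itv/=; [congr `|_|; ring|lra|lra].
Qed.

End ConeConvexity.

(** * The graph *)

Section Construction.
Context {R : realType}.
Variable P : nat -> nat * nat.
Hypothesis gP : forall n, admissible P n.
Hypotheses (P3 : P 3 = (0, 1)%N) (P4 : P 4 = (1, 2)%N).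

(** The edges are numbered from 0, the vertices that have parents from 3. *)
Definition edge_child (e : nat * bool) : nat := e.1.+3.

Definition edge_parent (e : nat * bool) : nat :=
  if e.2 then (P (edge_child e)).2 else (P (edge_child e)).1.

Lemma edge_parentP e : parent P (edge_child e) (edge_parent e).
Proof. by rewrite /parent /edge_parent; case: ifP => _; rewrite eqxx ?orbT. Qed.

Lemma edges_finite v :
  finite_set [set e | edge_child e = v \/ edge_parent e = v].
Proof.
apply: (@sub_finite_set _ _ (`I_(v + (2 ^ 10 + 4 * v)) `*` [set: bool])); last first.
  by apply: finite_setX.
move=> [i b] /= h; split=> //.
case: h => [<-|pv]; first by apply: ltn_addr; rewrite /edge_child /=; lia.
have := edge_parentP (i, b); rewrite pv => /(child_bound gP).
rewrite /edge_child /= => h; apply: ltn_addl; apply: leq_ltn_trans h; lia.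
Qed.

Lemma edges_connected (S : set nat) : S !=set0 ->
  (forall e, S (edge_child e) <-> S (edge_parent e)) -> forall v, S v.
Proof.
move=> [u Su] SE.
have S31 := SE (0%N, true); have S30 := SE (0%N, false).
have S41 := SE (1%N, false); have S42 := SE (1%N, true).
move: S31 S30 S41 S42; rewrite /edge_parent /edge_child /= P3 P4 /= => S31 S30 S41 S42.
have S0 n : S n <-> S 0%N.
  elim/ltn_ind: n => -[|[|[|n]]] IH; [by []|tauto|tauto|].
  have e := SE (n, false); rewrite /edge_child /= in e; rewrite e; apply: IH.
  by have := parent_lt gP (edge_parentP (n, false)).
by move=> v; apply: (S0 v).2; exact: (S0 u).1.
Qed.

Definition tower : graph_data R :=
  @GraphData R nat (nat * bool)%type edge_child edge_parent (fun e => arm (edge_child e))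
    (fun e => arm_gt0 _) edges_finite edges_connected.

Local Notation Y := (point tower).
Local Notation node n := (@at_vertex R tower n).

Lemma edge_parent_lt e : (edge_parent e < edge_child e)%N.
Proof. have h := parent_lt gP (edge_parentP e). exact: h. Qed.

Lemma edge_weight e : weight (edge_child e) (edge_parent e) = arm (edge_child e) :> R.
Proof. by rewrite /weight (maxn_idPl (ltnW (edge_parent_lt e))). Qed.

Lemma edge_adj e : adj P (edge_child e) (edge_parent e).
Proof. by rewrite /adj edge_parentP. Qed.

(** Different edges have different ends, since the two parents of a vertex are
distinct. *)
Lemma edge_avoid e0 e : e != e0 ->
  avoid P (edge_child e0) (edge_parent e0) (edge_child e) (edge_parent e).
Proof.
move=> ne; rewrite /avoid edge_adj /= negb_or; apply/andP; split; last first.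
  apply/negP => /andP[/eqP ec /eqP pc].
  have := edge_parent_lt e; rewrite pc ec => /ltn_trans/(_ (edge_parent_lt e0)).
  by rewrite ltnn.
apply/negP => /andP[/eqP cc /eqP pp]; case: e e0 cc pp ne => [i b] [j d] /= -[ij].
rewrite /edge_parent /edge_child /= ij => pp; have := parents_neq gP (isT : 2 < j.+3)%N.
by case: b d pp => -[] pp; first [by rewrite eqxx|by rewrite pp eqxx].
Qed.

Lemma tower_girth : ((2 * pi)%:E <= girth Y)%E.
Proof.
apply: realization_girth => e0.
have [g [g0 g1 gi gl _]] := @edge_potential R P gP _ _ (edge_adj e0).
exists g; rewrite /= -edge_weight; split=> // e ne.
by rewrite -edge_weight; apply/gl/edge_avoid.
Qed.

Definition vertex_height (n : nat) : R := height (level n).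

Lemma vertex_height_lip (e : gedge tower) :
  `|vertex_height (gsrc e) - vertex_height (gtgt e)| <= glen e.
Proof.
rewrite /vertex_height /= (level_parent gP (edge_parentP e)) /arm.
case: (level _) => [|k] /=; first by rewrite subrr normr0 ltW// level_arm_gt0.
by rewrite heightS addrC addKr gtr0_norm// level_arm_gt0.
Qed.

Lemma tower_proper : proper_space Y.
Proof.
apply: (realization_proper vertex_height_lip) => r.
have [K rK] := @height_unbounded R r.
apply: (@sub_finite_set _ _ `I_(2 ^ (K + 10))) => // n /= nr.
apply: level_lt; rewrite ltnNge; apply/negP => /(@le_height R) Kn.
by move: (lt_le_trans rK (le_trans Kn nr)); rewrite ltxx.
Qed.

Lemma height_mdist m n :
  vertex_height n - vertex_height m <= mdist (node m) (node n).
Proof.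
have := graph_dist_lipschitz (node m) (node n)
  (interpolate_lipschitz vertex_height_lip).
by rewrite distrC; apply: le_trans; exact: ler_norm.
Qed.

Lemma tower_far m (M : R) : exists K, forall k, (K <= k)%N ->
  M <= mdist (node m) (node (2 ^ (k + 10))%N).
Proof.
have [K MK] := @height_unbounded R (M + vertex_height m).
exists K => k Kk; apply: le_trans (height_mdist _ _).
rewrite lerBrDr (le_trans (ltW MK))// /vertex_height level_exp.
exact: le_height.
Qed.

Lemma tower_unbounded : unbounded_space Y.
Proof.
move=> M; have [K /(_ K (leqnn K)) far] := tower_far 0 (M + 1).
exists (node 0%N), (node (2 ^ (K + 10))%N).
by apply: lt_le_trans far; rewrite ltrDl.
Qed.

(** The arc with midpoint i + 3, which is at 0, from the first parent to the second. *)
Definition cap (i : nat) (t : R) : Y :=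
  if t <= 0 then @param R tower (i, false) (- t) else @param R tower (i, true) t.

(** The potential of the edge to the second parent maps the cap to an arc of length
2 l < pi of the circle of length 2 pi. Composing it with the distance on the
circle from the image of the second parent gives the function phi, which is
1-Lipschitz on the graph and unrolls the cap. *)
Lemma cap_isometric i : isometric_on (cap i) (- arm i.+3) (arm i.+3).
Proof.
set l := arm i.+3; have l0 : 0 < l := arm_gt0 _.
have lpi : l < pi / 2 := arm_lt_pihalf _.
pose e0 := (i, true); pose e1 := (i, false).
have [g [g0 g1 gi gl gz]] := @edge_potential R P gP _ _ (edge_adj e0).
rewrite edge_weight -/l in g1 gi.
have ga : g (edge_parent e1) = l.
  rewrite gz; [exact: (edge_weight e1)|exact: (edge_adj e1)|].
  by rewrite /edge_parent /= (parents_neq gP).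
pose phi v : R := pi - `|g v + l - pi|.
have phi0 : phi (edge_child e0) = l.
  by rewrite /phi g0 add0r ler0_norm; lra.
have phi1 : phi (edge_parent e0) = 0.
  by rewrite /phi g1 ger0_norm; lra.
have phia : phi (edge_parent e1) = 2 * l.
  by rewrite /phi ga ler0_norm; lra.
have phi_lip (e : gedge tower) : `|phi (gsrc e) - phi (gtgt e)| <= glen e.
  have [ee|ne] := eqVneq e e0.
    by rewrite ee /= phi0 phi1 subr0 gtr0_norm.
  have := gl _ _ (edge_avoid ne); rewrite edge_weight; apply: le_trans.
  rewrite /phi /=; set u := g (edge_child e); set v := g (edge_parent e).
  have -> : pi - `|u + l - pi| - (pi - `|v + l - pi|) =
      `|v + l - pi| - `|u + l - pi| by ring.
  apply: le_trans (ler_dist_dist _ _) _.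
  have -> : v + l - pi - (u + l - pi) = - (u - v) by ring.
  by rewrite normrN.
have lip := interpolate_lipschitz phi_lip.
have in0 t : - l <= t -> t <= 0 -> - t \in `[0, l].
  by move=> h1 h2; rewrite in_itv/= oppr_ge0 h2 lerNl h1.
have in1 t : 0 < t -> t <= l -> t \in `[0, l].
  by move=> h1 h2; rewrite in_itv/= (ltW h1).
have phicap t : - l <= t <= l -> @interpolate R tower phi (cap i t) = l - t.
  move=> /andP[lt tl]; rewrite /cap; case: (leP t 0) => t0.
    rewrite interpolate_param ?in0// /= phi0 phia -/l.
    by field; rewrite (gt_eqF l0).
  rewrite interpolate_param ?in1// /= phi0 phi1 -/l.
  by field; rewrite (gt_eqF l0).
have apex b : @param R tower (i, b) 0 = node i.+3 by rewrite param0.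
have near0 t : - l <= t <= l -> mdist (cap i t) (node i.+3) <= `|t|.
  move=> /andP[lt tl]; rewrite /cap; case: (leP t 0) => t0.
    rewrite -(apex false); apply: le_trans (graph_dist_param_le _ _) _.
    - exact: in0.
    - by rewrite in_itv/= lexx ltW.
    - by rewrite subr0 normrN.
  rewrite -(apex true); apply: le_trans (graph_dist_param_le _ _) _.
  - exact: in1.
  - by rewrite in_itv/= lexx ltW.
  - by rewrite subr0.
move=> s t; rewrite !in_itv/= => si ti; apply/eqP; rewrite eq_le; apply/andP; split; last first.
  have := graph_dist_lipschitz (cap i s) (cap i t) lip.
  by rewrite !phicap// distrC; have -> : l - t - (l - s) = s - t by ring.
have [st|st] : (s <= 0) = (t <= 0) \/ (s <= 0) <> (t <= 0).
  by case: (s <= 0); case: (t <= 0); auto.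
- rewrite /cap -st; case: (leP s 0) => s0.
    have t0 : t <= 0 by rewrite -st.
    move: si ti => /andP[? ?] /andP[? ?].
    apply: le_trans (graph_dist_param_le _ _) _; [exact: in0|exact: in0|].
    have -> : - s - - t = - (s - t) by ring.
    by rewrite normrN.
  have t0 : 0 < t by rewrite ltNge -st -ltNge.
  move: si ti => /andP[? ?] /andP[? ?].
  by apply: graph_dist_param_le; exact: in1.
have := metric_triangle (cap i s) (node i.+3) (cap i t).
rewrite [mdist (node _) _]metric_sym => /le_trans; apply.
apply: le_trans (lerD (near0 _ si) (near0 _ ti)) _.
case: (leP s 0) st => s0; case: (leP t 0) => t0 // _.
  by rewrite (ler0_norm s0) (gtr0_norm t0) ler0_norm; lra.
by rewrite (gtr0_norm s0) (ler0_norm t0) ger0_norm; lra.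
Qed.

End Construction.

(** * The convex hull of the roots *)

Section Hull.
Context {R : realType}.
Variable P : nat -> nat * nat.
Hypothesis gP : forall n, admissible P n.
Hypotheses (P3 : P 3 = (0, 1)%N) (P4 : P 4 = (1, 2)%N).

Local Notation tower := (@tower R P gP P3 P4).
Local Notation Y := (point tower).
Local Notation node n := (@at_vertex R tower n).
Local Notation cap := (@cap R P gP P3 P4).

Definition roots : set Y := [set node n | n in `I_3].

Let C := convex_hull (unit_sphere_pt @` roots).

Lemma hull_convex : geodesically_convex C.
Proof.
move=> x y Cx Cy z xyz B [Bconv AB]; apply: (Bconv x y) xyz.
  exact: Cx.
exact: Cy.
Qed.

Lemma hull_root n : (n < 3)%N -> C (polar 1 (node n)).
Proof.
move=> n3; apply: sub_gen_smallest; exists (node n); first by exists n.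
by rewrite (polar_pos ltr01).
Qed.

Lemma cap_apex i : cap i 0 = node i.+3.
Proof. by rewrite /cap lexx oppr0 param0. Qed.

Lemma cap_left i : cap i (- arm i.+3) = node (P i.+3).1.
Proof.
rewrite /cap oppr_le0 ltW ?arm_gt0// opprK.
exact: (@param_len R tower (i, false)).
Qed.

Lemma cap_right i : cap i (arm i.+3) = node (P i.+3).2.
Proof.
rewrite /cap leNgt arm_gt0; exact: (@param_len R tower (i, true)).
Qed.

(** The radii are not controlled here: at this stage the hull is not known to be
star-shaped, and the two parents may have been reached at different radii. *)
Lemma hull_vertex n : exists2 r, 0 < r & C (polar r (node n)).
Proof.
elim/ltn_ind: n => n IH; have [n3|n3] := ltnP n 3.
  by exists 1 => //; exact: hull_root.
case: n n3 IH => [|[|[|i]]] // _ IH.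
have [an bn _ _ _] := gP (isT : 2 < i.+3)%N.
have [r r0 Cr] := IH _ an; have [s s0 Cs] := IH _ bn.
have l0 := @arm_gt0 R i.+3; have lpi := @arm_lt_pihalf R i.+3.
have := @chord_mem_pos R Y C hull_convex r s (fun t => cap i (t - arm i.+3))
  (2 * arm i.+3) (arm i.+3) r0 s0.
rewrite subrr cap_apex; apply.
- by apply/andP; split; lra.
- move=> u v; rewrite !in_itv/= => ui vi; rewrite cap_isometric ?in_itv/=.
  + by congr `|_|; ring.
  + by move: ui; lra.
  + by move: vi; lra.
- by rewrite in_itv/=; apply/andP; split; lra.
- by rewrite sub0r cap_left.
- by rewrite mulr2n mulrDl mul1r addrK cap_right.
Qed.

Lemma hull_tip : C tip.
Proof.
have [K /(_ K (leqnn K)) far] := @tower_far R P gP P3 P4 0 (pi : R).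
have [r r0 Cr] := hull_vertex 0; have [s s0 Cs] := hull_vertex (2 ^ (K + 10))%N.
exact: (tip_mem hull_convex r0 s0 far Cr Cs).
Qed.

(** The chord between the points over the ends of the cap has distance
p * cos (arm (i + 3)) from the tip. *)
Lemma hull_cap i p t : 0 < p -> t \in `[- arm i.+3, arm i.+3] ->
  C (polar p (node (P i.+3).1)) -> C (polar p (node (P i.+3).2)) ->
  C (polar (p * cos (arm i.+3)) (cap i t)).
Proof.
move=> p0 ti Ca Cb; set l := arm i.+3 in ti *.
have l0 : 0 < l := arm_gt0 _; have lpi : l < pi / 2 := arm_lt_pihalf _.
have cl : 0 < cos l by apply: cos_gt0_pihalf; apply/andP; split; lra.
have ct : 0 < cos t.
  by apply: cos_gt0_pihalf; move: ti; rewrite in_itv/= => /andP[? ?]; apply/andP; split; lra.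
have q0 : 0 < p * cos l by rewrite mulr_gt0.
apply: (@ray_mem _ _ _ hull_convex (p * cos l / cos t)).
- exact: hull_tip.
- by rewrite ltW//= ler_pdivlMr// ler_piMr ?cos_le1// ltW.
apply: (@chord_mem _ _ _ hull_convex _ _ (- l) l) => //.
- by rewrite ltrN2.
- exact: cap_isometric.
- by rewrite cosN mulfK ?gt_eqF// cap_left.
- by rewrite mulfK ?gt_eqF// cap_right.
Qed.

Lemma hull_shrink r s y : C (polar r y) -> 0 <= s <= r -> C (polar s y).
Proof. by move=> Cr sr; exact: (ray_mem hull_convex hull_tip sr Cr). Qed.

Lemma hull_level0 : exists2 r, 0 < r & forall n, level n = 0%N -> C (polar r (node n)).
Proof.
(* The vertices of level 0 are those below 2 ^ 11. *)
suff [r r0 Cr] : exists2 r, 0 < r & forall n, (n < 2 ^ 11)%N -> C (polar r (node n)).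
  by exists r => // n n0; apply: Cr; apply: (@level_lt 1); rewrite n0.
elim: (2 ^ 11)%N => [|m [r r0 Cr]]; first by exists 1.
have [s s0 Cs] := hull_vertex m.
exists (Num.min r s) => [|n]; first by rewrite lt_min r0.
have m0 : 0 <= Num.min r s by rewrite le_min !ltW.
rewrite ltnS leq_eqVlt => /predU1P[->|nm].
  by apply: hull_shrink Cs _; rewrite m0 ge_min lexx orbT.
by apply: hull_shrink (Cr _ nm) _; rewrite m0 ge_min lexx.
Qed.

Lemma hull_levels : exists2 r, 0 < r & forall n,
  C (polar (r * \prod_(j < level n) cos (level_arm j.+1)) (node n)).
Proof.
have [r r0 Cr] := hull_level0; exists r => // n.
move: {2}(level n) (erefl (level n)) => k; elim: k n => [|k IH] n nk.
  by rewrite nk big_ord0 mulr1; exact: Cr.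
have n3 : (2 < n)%N.
  rewrite ltnNge; apply/negP => n2.
  by move: nk; rewrite /level (_ : (trunc_log 2 n - 10)%N = 0%N)//; case: n n2 => [|[|[|]]].
case: n n3 nk => [|[|[|i]]] // _ ik.
have par v : parent P i.+3 v -> level v = k.
  by move=> /(level_parent gP) ->; rewrite ik.
rewrite -cap_apex ik big_ord_recr /= mulrA -ik.
apply: hull_cap.
- by rewrite mulr_gt0// prodr_gt0// => j _; exact: cos_level_arm_gt0.
- by rewrite in_itv/= oppr_le0 ltW ?arm_gt0.
- have lv : level (P i.+3).1 = k by apply: par; rewrite /parent eqxx.
  by have := IH _ lv; rewrite lv.
- have lv : level (P i.+3).2 = k by apply: par; rewrite /parent eqxx orbT.
  by have := IH _ lv; rewrite lv.
Qed.

(** Over the vertices the radii are bounded below by [prod_cos_bounded]; over the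
interior of an edge there is one more factor, which is smallest at level 0. *)
Lemma hull_uniform : exists2 d, 0 < d & forall y : Y, C (polar d y).
Proof.
have [r r0 Cr] := hull_levels; have [c c0 cP] := @prod_cos_bounded R.
have Crc n : C (polar (r * c) (node n)).
  apply: hull_shrink (Cr n) _; apply/andP; split; last by rewrite ler_pM2l.
  by rewrite mulr_ge0 ?ltW.
pose d := r * c * cos (level_arm 0).
have rc0 : 0 < r * c by rewrite mulr_gt0.
have d0 : 0 < d by rewrite mulr_gt0// cos_level_arm_gt0.
exists d => // -[n|[i b] t h].
  apply: hull_shrink (Crc n) _.
  by rewrite ltW//= ler_piMr ?cos_le1// ltW.
have /andP[t0 tl] := h; rewrite /= /edge_child /= in tl.
pose s := if b then t else - t.
have -> : on_edge h = cap i s.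
  rewrite -(param_inner h) /cap /s; case: b s h tl => s h tl.
    by rewrite leNgt t0.
  by rewrite oppr_le0 (ltW t0) opprK.
have si : s \in `[- arm i.+3, arm i.+3].
  by rewrite /s in_itv/=; case: (b); apply/andP; split; lra.
apply: hull_shrink (hull_cap rc0 si (Crc _) (Crc _)) _.
rewrite ltW//= /d ler_pM2l// le_eqVlt; apply/orP.
have lpi k : level_arm k \in `[0, (pi : R)].
  rewrite in_itv/= ltW ?level_arm_gt0//=.
  by have := @level_arm_lt_pihalf R k; have := @pi_gt0 R; lra.
have := @le_arm R 0 i.+3 isT; rewrite le_eqVlt => /predU1P[->|ll]; first by left.
by right; rewrite ltr_cos// lpi.
Qed.

Lemma hull_nbhs_tip : nbhs (tip : cone R Y) C.
Proof.
have [d d0 Cd] := hull_uniform.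
apply/nbhs_mdist; exists d => // -[|r r0 y] lt; first exact: hull_tip.
by rewrite -(polar_pos r0); apply: hull_shrink (Cd y) _; rewrite !ltW.
Qed.

(** The points of radius d over vertices of increasing height: a cluster point would
have two of them within d, but they can be chosen 2 d apart. *)
Lemma hull_not_precompact : ~ compact (closure C).
Proof.
have [d d0 Cd] := hull_uniform => cpt.
pose x k : cone R Y := polar d (node (2 ^ (k + 10))%N).
have xC k : closure C (x k) by apply: subset_closure; exact: Cd.
have [p [_ clp]] : closure C `&` cluster (x @ \oo) !=set0.
  by apply: (cpt _ _); exists 0%N => // k _; exact: xC.
have ballp : nbhs p [set z | mdist p z < d] by apply/nbhs_mdist; exists d.
have meet N : exists2 k, (N <= k)%N & mdist p (x k) < d.
  have /(clp _ _)/(_ ballp)[z [[k Nk <-] pk]] : (x @ \oo) (x @` [set k | (N <= k)%N]).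
    by exists N => // k Nk /=; exists k.
  by exists k.
have [k _ pk] := meet 0%N.
have [K far] := @tower_far R P gP P3 P4 (2 ^ (k + 10))%N (pi : R).
have [m Km pm] := meet K.
have := metric_triangle (x k) p (x m); rewrite (metric_sym (x k) p).
rewrite (polar_mdist_opposite (far m Km)) ?(ltW d0)//.
by lra.
Qed.

End Hull.

Theorem theorem1p1 (R : realType) :
  exists (Y : metricType R) (G : metric_graph Y) (A : set Y),
    [/\ proper_space Y,
        unbounded_space Y,
        ((2 * pi)%:E <= girth Y)%E
      & (A #= `I_3)%card] /\
    [/\ nbhs (tip : cone R Y) (convex_hull (unit_sphere_pt @` A))
      & ~ compact (closure (convex_hull (unit_sphere_pt @` A)))].
Proof.
have [P [P3 P4 gP]] := exists_parents.
exists (point (@tower R P gP P3 P4)), (realization_graph), (@roots R P gP P3 P4).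
split; split.
- exact: tower_proper.
- exact: tower_unbounded.
- exact: tower_girth.
- by apply: inj_card_eq => m n _ _ [].
- exact: hull_nbhs_tip.
- exact: hull_not_precompact.
Qed.
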